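(* Let $P_0,P_1$ be probability measures on a measurable space $(\mathcal X,\mathcal B_{\mathcal X})$ with $P_1\ll P_0$ and $\mathrm{KL}(P_1\|P_0)<\infty$, let $R=\frac{dP_1}{dP_0}$, and let $\mathcal E$ be the set of measurable $E:\mathcal X\to[0,\infty]$ with $\mathbb E_{P_0}[E]\le1$. (a) $\displaystyle\sup_{E\in\mathcal E}\mathbb E_{P_1}[\log E]=\mathrm{KL}(P_1\|P_0)$, and the supremum is attained, at $E=R$ and, up to $P_0$-null modification, only there. (b) $\displaystyle\sup_{E\in\mathcal E}\Lambda(E)=\mathrm{KL}(P_0\|P_1)$, and if $P_0$ and $P_1$ are mutually absolutely continuous, $\mathrm{KL}(P_0\|P_1)<\infty$ and $\log R$ is not $P_0$-a.s. constant, the supremum is attained by no $E\in\mathcal E$; indeed for every betting sequence in the i.i.d. model and every $t\in\mathbb N$ one then has $\Lambda^{(t)}<\mathrm{KL}(P_0\|P_1)$.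
   Context: $\Lambda(E):=\sup_{s\ge0}\{-\log\mathbb E_{P_1}[E^{-s}]\}$. For $E\in\mathcal E$ the positive part of $\log E$ is $P_1$-integrable under the stated assumptions, so $\mathbb E_{P_1}[\log E]\in[-\infty,\infty)$ is well defined. $\mathrm{KL}(Q\|P)=\mathbb E_Q[\log\frac{dQ}{dP}]$ if $Q\ll P$, $+\infty$ otherwise. I.i.d. model: $\Omega=\mathcal X^{\mathbb N}$, coordinates $X_n$, $\mathcal F_t=\sigma(X_1,\dots,X_t)$, $\mathbb P_i=P_i^{\otimes\mathbb N}$. A betting sequence is a sequence $(E_t)_{t\in\mathbb N}$ of $\mathcal F_t$-measurable $E_t:\Omega\to[0,\infty]$ with $\mathbb E_{\mathbb P_0}[E_t\mid\mathcal F_{t-1}]\le1$ $\mathbb P_0$-a.s.; $W_t=\prod_{n\le t}E_n$; $\Lambda^{(t)}:=\sup_{s\ge0}\{-\frac1t\log\mathbb E_{\mathbb P_1}[W_t^{-s}]\}$. Conventions: $\log0=-\infty$; $x^0=1$; for $s>0$, $0^{-s}=+\infty$, $(+\infty)^{-s}=0$; $0\cdot\infty=0$; $\log(+\infty)=+\infty$. *)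

(* Defs.v *)
From HB Require Import structures.
From mathcomp Require Import all_boot all_order all_algebra.
From mathcomp Require Import all_classical all_reals all_analysis.
From mathcomp Require Import measurable_realfun.

Set Implicit Arguments.
Unset Strict Implicit.
Unset Printing Implicit Defensive.

Import Order.TTheory GRing.Theory Num.Theory.
Import numFieldNormedType.Exports.

Local Open Scope classical_set_scope.
Local Open Scope ring_scope.
Local Open Scope charge_scope.
Local Open Scope ereal_scope.

(* [\bar R] already follows the usual conventions: [lne 0 = -oo],
   [lne +oo = +oo] and [0 * +oo = 0].  The library's [poweR 0 (- s)] is 0
   for [s > 0], so [x^{-s}] is written as the extended inverse (with
   [0^-1 = +oo] and [+oo^-1 = 0]) of [poweR x s]. *)
Definition npoweR (R : realType) (x : \bar R) (s : R) : \bar R :=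
  (poweR x s)^-1.

Section Divergence.
Context d (X : measurableType d) (R : realType).

(* [f] is a [[0, +oo]]-valued version of dQ/dP.  The library's
   ['d Q '/d P] is one particular version, which is real valued but possibly
   negative on a [P]-null set; it is meaningful only when [Q `<< P]. *)
Definition is_density (Q P : probability X R) (f : X -> \bar R) : Prop :=
  [/\ measurable_fun [set: X] f,
      forall x, 0 <= f x &
      ae_eq P [set: X] f ('d (charge_of_finite_measure Q) '/d P)].

Definition KL (Q P : probability X R) : \bar R :=
  if `[< Q `<< P >] then
    \int[Q]_x lne ('d (charge_of_finite_measure Q) '/d P x)
  else +oo.

Definition evars (P0 : probability X R) : set (X -> \bar R) :=
  [set E | [/\ measurable_fun [set: X] E,
               forall x, 0 <= E x &
               \int[P0]_x E x <= 1]].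

Definition Lambda (P1 : probability X R) (E : X -> \bar R) : \bar R :=
  ereal_sup [set - lne (\int[P1]_x npoweR (E x) s) | s in [set s : R | (0 <= s)%R]].

End Divergence.

Section CoordinateSpace.
Context d (X : measurableType d).

(* Trajectories are 0-indexed: the coordinate X_{n+1} is [fun w => w n]. *)
Definition coord_sets (I : set nat) : set (set (nat -> X)) :=
  \bigcup_(n in I)
     preimage_set_system [set: nat -> X] (fun w : nat -> X => w n) measurable.

End CoordinateSpace.

(* [nat -> X] with the product sigma-algebra. *)
Notation trajectories X := (g_sigma_algebraType (@coord_sets _ X [set: nat])).

(* [nat -> X] with F_t, the sigma-algebra of the first t coordinates. *)
Notation filtration X t := (g_sigma_algebraType (@coord_sets _ X `I_t)).

Section IidModel.
Context d (X : measurableType d) (R : realType).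

(* The infinite product measure is not in the library.  It is the unique
   probability on the product sigma-algebra that gives measurable rectangles
   the product of the masses of their sides. *)
Definition is_iid_product (P : probability X R)
    (PP : probability (trajectories X) R) : Prop :=
  forall (n : nat) (A : nat -> set X),
    (forall i, measurable (A i)) ->
    PP [set w | forall i, (i < n)%N -> A i (w i)] = \prod_(i < n) P (A i).

(* [Z] is a version of the conditional expectation of the nonnegative [Y]
   given F_t. *)
Definition is_cond_expectation (PP : probability (trajectories X) R) (t : nat)
    (Y Z : (nat -> X) -> \bar R) : Prop :=
  [/\ measurable_fun [set: filtration X t] (Z : filtration X t -> \bar R),
      forall w, 0 <= Z w &
      forall A : set (filtration X t), measurable A ->
        \int[PP]_(w in (A : set (trajectories X))) Z w =
        \int[PP]_(w in (A : set (trajectories X))) Y w].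

(* [E n] is the bet usually indexed n+1, i.e. E_{n+1}: it is F_{n+1}-measurable and its
   conditional expectation given F_n is at most 1. *)
Definition betting_sequence (PP0 : probability (trajectories X) R)
    (E : nat -> (nat -> X) -> \bar R) : Prop :=
  forall n : nat,
    [/\ measurable_fun [set: filtration X n.+1]
          (E n : filtration X n.+1 -> \bar R),
        forall w, 0 <= E n w &
        exists Z, is_cond_expectation PP0 n (E n) Z /\
                  {ae PP0, forall w, Z w <= 1}].

Definition wealth (E : nat -> (nat -> X) -> \bar R) (t : nat) (w : nat -> X) :
    \bar R :=
  \prod_(n < t) E n w.

(* For [t > 0]; the wealth process is [wealth E t] = E_1 * ... * E_t. *)
Definition Lambda_path (PP1 : probability (trajectories X) R)
    (E : nat -> (nat -> X) -> \bar R) (t : nat) : \bar R :=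
  ereal_sup [set - ((t%:R^-1)%:E * lne (\int[PP1]_w npoweR (wealth E t w) s))
            | s in [set s : R | (0 <= s)%R]].

End IidModel.

(* Main.v *)
(* (a) is Gibbs' inequality: ln (E/R) <= E/R - 1 pointwise, and the integral of
   E/R under P1 is at most 1.

   (b), upper bound. With l = ln R and K = KL(P0||P1) one has
   E_{P1}[E^{-s}] = E_{P0}[exp (l - s ln E)], and e^u >= 1 + u at
   u = l + K - s ln E gives E_{P1}[E^{-s}] >= e^{-K}.  The inequality is strict
   uniformly in s: a slope slightly larger than 1 on {l > -K} gains a fixed
   amount, while the resulting loss, linear in s, is absorbed by
   s E_{P0}[-ln E], which is positive unless E = 1 a.s.

   (b), sharpness. E_n = R^{1/n} / m_n with m_n = E_{P0}[R^{1/n}] satisfies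
   E_{P1}[E_n^{-n}] <= m_n^n, so Lambda(E_n) >= -n ln m_n >= n (1 - m_n), and
   Fatou's lemma bounds liminf n (1 - m_n) from below by E_{P0}[- ln R].

   (b), betting. On F_t the law PP1 has density exp (l(X_1) + ... + l(X_t)) with
   respect to PP0, whose relative entropy is t K, and the wealth W_t is an
   e-variable for PP0; so the strict one-step bound applies to W_t. *)

Require Import Defs.
From HB Require Import structures.
From mathcomp Require Import all_boot all_order all_algebra.
From mathcomp Require Import all_classical all_reals all_analysis.
From mathcomp Require Import measurable_realfun ring lra.

Set Implicit Arguments.
Unset Strict Implicit.
Unset Printing Implicit Defensive.

Import Order.TTheory GRing.Theory Num.Theory.
Import numFieldNormedType.Exports.

Local Open Scope classical_set_scope.
Local Open Scope ring_scope.
Local Open Scope ereal_scope.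

(** * Extended logarithms and negative powers *)

Lemma measurable_lne (R : realType) : measurable_fun [set: \bar R] (@lne R).
Proof.
rewrite [X in measurable_fun _ X](_ : _ = fun x : \bar R =>
    if x == +oo then +oo else if x <= 0 then -oo else (ln (fine x))%:E).
  apply: measurable_fun_ifT => //=; first exact: measurable_fun_eqe.
  apply: measurable_fun_ifT => //=; first exact: measurable_fun_lee.
  apply/measurable_EFinP; apply: measurableT_comp; first exact: measurable_ln.
  by [].
by apply/funext => -[x| |] //=; rewrite leNye.
Qed.

(** Turns a lower bound on the integral of a negative power into an upper bound on the corresponding
    term of the supremum defining [Lambda]. *)
Lemma oppe_lne_le (R : realType) (k : R) (y : \bar R) :
  (expR (- k))%:E <= y -> - lne y <= k%:E.
Proof.
move=> ky; rewrite leeNl -EFinN -[leLHS]expeRK.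
rewrite lee_lne//= in_itv/= leey ?lee_fin ?expR_ge0//.
by rewrite (le_trans _ ky)// lee_fin expR_ge0.
Qed.

Lemma npoweR_ge0 (R : realType) (x : \bar R) s : 0 <= npoweR x s.
Proof. by rewrite /npoweR inve_ge0 poweR_ge0. Qed.

Lemma measurable_npoweR (R : realType) (s : R) :
  measurable_fun [set: \bar R] (fun x => npoweR x s).
Proof.
have [->|s0] := eqVneq s 0%R.
  rewrite [X in measurable_fun _ X](_ : _ = cst 1)//.
  by apply/funext => x; rewrite /npoweR poweRe0 inve1.
rewrite [X in measurable_fun _ X](_ : _ = fun x : \bar R =>
    if x == +oo then 0 else if x == -oo then +oo else
    if x == 0 then +oo else (fine x `^ (- s))%:E).
  apply: measurable_fun_ifT => //=; first exact: measurable_fun_eqe.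
  apply: measurable_fun_ifT => //=; first exact: measurable_fun_eqe.
  apply: measurable_fun_ifT => //=; first exact: measurable_fun_eqe.
  apply/measurable_EFinP.
  exact: (@measurableT_comp _ _ _ _ _ _ (@powR R ^~ (- s)%R)).
apply/funext => -[x| |] //=; rewrite /npoweR/= ?(negbTE s0)// ?inve0//.
by rewrite inver powR_eq0 s0 andbT eqe powRN.
Qed.

(** * Finite measures given by a density, and change of variables *)

Section weighted.
Context d (T : measurableType d) (R : realType) (mu : {measure set T -> \bar R}).
Variable f : T -> \bar R.
Hypotheses (mf : measurable_fun [set: T] f) (f0 : forall x, 0 <= f x)
  (fi : \int[mu]_x f x < +oo).

(* The proof arguments are what lets the finite measure structure be inferred. *)
Definition weighted of measurable_fun [set: T] f & (forall x, 0 <= f x) &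
  \int[mu]_x f x < +oo := fun A : set T => \int[mu]_(x in A) f x.
Local Notation nu := (weighted mf f0 fi).

Let nu0 : nu set0 = 0. Proof. exact: integral_set0. Qed.

Let nu_ge0 A : 0 <= nu A. Proof. by apply: integral_ge0. Qed.

Let nu_sigma : semi_sigma_additive nu.
Proof. exact: semi_sigma_additive_nng_induced. Qed.

HB.instance Definition _ := isMeasure.Build _ _ _ nu nu0 nu_ge0 nu_sigma.

Let nu_fin : fin_num_fun nu.
Proof.
move=> A mA; rewrite ge0_fin_numE//; apply: le_lt_trans fi.
by apply: ge0_subset_integral => //; exact: measurable_funTS.
Qed.

HB.instance Definition _ := Measure_isFinite.Build _ _ _ nu nu_fin.

End weighted.

Section density.
Context d (T : measurableType d) (R : realType).

(** Having the same integrals over all measurable sets, [f] agrees [mu]-a.e. with the Radon-Nikodym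
    derivative, and the change of variables for the latter transfers. *)
Lemma integral_density (nu mu : {finite_measure set T -> \bar R})
    (f h : T -> \bar R) :
  measurable_fun [set: T] f -> (forall x, 0 <= f x) ->
  (forall A, measurable A -> nu A = \int[mu]_(x in A) f x) ->
  measurable_fun [set: T] h -> (forall x, 0 <= h x) ->
  \int[nu]_x h x = \int[mu]_x (h x * f x).
Proof.
move=> mf f0 nuE mh h0.
have numu : nu `<< mu.
  apply/null_content_dominatesP => A mA muA; rewrite nuE//.
  by apply: null_set_integral => //; exact: measurable_funTS.
rewrite -(Radon_Nikodym_SigmaFinite.change_of_variables numu)//.
have mg := measurable_int _ (Radon_Nikodym_SigmaFinite.f_integrable numu).
apply: ae_eq_integral => //; [exact: emeasurable_funM|exact: emeasurable_funM|].
apply: ae_eqe_mul2l; apply: ae_eq_sym; apply: integral_ae_eq => //.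
  apply/integrableP; split => //; under eq_integral do rewrite gee0_abs//.
  by rewrite -nuE// ltey_eq fin_num_measure.
move=> A _ mA; rewrite -nuE//.
exact: Radon_Nikodym_SigmaFinite.f_integral.
Qed.

Lemma integral_weighted (mu : {finite_measure set T -> \bar R}) f
    (mf : measurable_fun [set: T] f) (f0 : forall x, 0 <= f x)
    (fi : \int[mu]_x f x < +oo) h :
  measurable_fun [set: T] h -> (forall x, 0 <= h x) ->
  \int[weighted mf f0 fi]_x h x = \int[mu]_x (h x * f x).
Proof. by move=> mh h0; apply: integral_density. Qed.

End density.

(** * Comparison of integrals of functions ordered almost everywhere *)

Section ae_le.
Context d (T : measurableType d) (R : realType) (mu : {measure set T -> \bar R}).
Implicit Types f g : T -> \bar R.

Let ae_le_funepos f g : {ae mu, forall x, f x <= g x} ->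
  {ae mu, forall x, [set: T] x -> f^\+ x <= g^\+ x}.
Proof.
apply: filterS => x fg _; rewrite !funeposE ge_max le_max fg/=.
by rewrite le_max lexx orbT.
Qed.

Let ae_le_funeneg f g : {ae mu, forall x, f x <= g x} ->
  {ae mu, forall x, [set: T] x -> g^\- x <= f^\- x}.
Proof.
apply: filterS => x fg _; rewrite !funenegE ge_max le_max leeN2 fg/=.
by rewrite le_max lexx orbT.
Qed.

(** Positive and negative parts are compared separately, so infinite integrals are covered, such as
    a mean of [lne E] equal to [-oo]. *)
Lemma ae_le_integral f g : measurable_fun [set: T] f -> measurable_fun [set: T] g ->
  {ae mu, forall x, f x <= g x} -> \int[mu]_x f x <= \int[mu]_x g x.
Proof.
move=> mf mg fg; rewrite integralE [leRHS]integralE leeB//.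
- apply: ae_ge0_le_integral => //; [exact: measurable_funepos..|].
  exact: ae_le_funepos.
- apply: ae_ge0_le_integral => //; [exact: measurable_funeneg..|].
  exact: ae_le_funeneg.
Qed.

(** The equality case of monotonicity. An infinite integral of [f^\-] would make the integral of [f]
    equal to [-oo], and [f^\+] is dominated by [g^\+]; so [f] is integrable, and [g - f] is
    nonnegative a.e. with integral zero. *)
Lemma ae_eq_le_integral f g : measurable_fun [set: T] f ->
  mu.-integrable [set: T] g ->
  {ae mu, forall x, f x <= g x} -> \int[mu]_x g x <= \int[mu]_x f x ->
  {ae mu, forall x, f x = g x}.
Proof.
move=> mf ig fg gf; have mg := measurable_int _ ig.
have fp : \int[mu]_x f^\+ x < +oo.
  apply: le_lt_trans (integral_funepos_lt_pinfty measurableT ig).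
  apply: ae_ge0_le_integral => //; [exact: measurable_funepos..|].
  exact: ae_le_funepos.
have igE := integrable_fin_num measurableT ig.
have fn : \int[mu]_x f^\- x < +oo.
  rewrite ltey; apply/eqP => fnE; move: gf; rewrite [leRHS]integralE fnE/=.
  have fp' : \int[mu]_x f^\+ x \is a fin_num.
    by rewrite ge0_fin_numE// integral_ge0.
  by rewrite addeNy leeNy_eq => /eqP E; rewrite E in igE.
have iff : mu.-integrable [set: T] f.
  apply/integrableP; split => //.
  rewrite -[fun x => _]/(abse \o f) fune_abse ge0_integralD//.
  - by rewrite lte_add_pinfty.
  - exact: measurable_funepos.
  - exact: measurable_funeneg.
have : \int[mu]_x `|(g \- f) x| = 0.
  apply: le_anti; rewrite integral_ge0// andbT.
  rewrite -[leRHS](subee igE).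
  have -> : \int[mu]_x `|(g \- f) x| = \int[mu]_x (g \- f) x.
    apply: ae_eq_integral => //.
    - by apply: measurableT_comp => //; exact: emeasurable_funB.
    - exact: emeasurable_funB.
    - apply: filterS2 fg (integrable_ae measurableT iff) => x fg /(_ I) ffin _.
      by rewrite gee0_abs// sube_ge0// ffin.
  rewrite integralB// leeB//.
move/ae_eq_integral_abs => /(_ measurableT (emeasurable_funB mg mf)) gf0.
apply: filterS3 gf0 (integrable_ae measurableT iff) (integrable_ae measurableT ig).
move=> x /(_ I)/= gf0 /(_ I) ffin /(_ I) gfin.
move: gf0; rewrite -(fineK ffin) -(fineK gfin) => -[] /eqP.
by rewrite subr_eq0 => /eqP ->.
Qed.

End ae_le.

(** * Pointwise exponential inequalities *)

Section real_inequalities.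
Context (R : realType).
Implicit Types a e s w u h : R.

(* Fenchel's inequality for [expR] at the slope [1 + h], with [h] substituted
   for [ln (1 + h)]. *)
Lemma expR_ge_slope u h : (0 <= h)%R -> ((1 + h) * (1 + u - h) <= expR u)%R.
Proof.
move=> h0; have [u1|u1] := leP 0%R (1 + u - h)%R; last first.
  by apply: le_trans (expR_ge0 u); rewrite mulr_ge0_le0// ?addr_ge0// ltW.
rewrite -[in leRHS](subrK h u) expRD [leRHS]mulrC.
by rewrite ler_pM ?expR_ge1Dx// ?addr_ge0// -addrA expR_ge1Dx.
Qed.

(** Slope [1] is used where [a <= 0] and slope [1 + e] where [a > 0]. With [q = sqrt w], the extra
    slope costs at most [e * s * w], because [2 (1 - q) + q^2 = 1 + (1 - q)^2] is nonnegative. *)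
Lemma expR_tilt_lower a e s w : (0 <= e)%R -> (0 <= s)%R -> (0 <= w)%R ->
  (1 + a + s * (2 * (1 - Num.sqrt w)) + e * Num.max a 0 - e * s * w - e ^+ 2
   <= expR (a + s * (2 * (1 - Num.sqrt w))))%R.
Proof.
move=> e0 s0 w0; have es0 : (0 <= e * s)%R by rewrite mulr_ge0.
have := sqr_sqrtr w0; set q := Num.sqrt w => qw.
have q0 : (0 <= q)%R by rewrite sqrtr_ge0.
have [a0|a0] := leP a 0%R.
  have := @expR_ge_slope (a + s * (2 * (1 - q)))%R 0%R (lexx _).
  have esw : (0 <= e * s * w)%R by rewrite mulr_ge0.
  have e2 : (0 <= e ^+ 2)%R by rewrite sqr_ge0.
  by rewrite addr0 mul1r subr0 mulr0; lra.
have := @expR_ge_slope (a + s * (2 * (1 - q)))%R e e0.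
apply: le_trans.
have -> : ((1 + e) * (1 + (a + s * (2 * (1 - q))) - e) = 1 + a + s * (2 * (1 - q))
   + e * a - e * s * w - e ^+ 2 + e * s * (1 + (1 - q) ^+ 2))%R.
  by rewrite -qw; ring.
by rewrite lerDl mulr_ge0// addr_ge0// sqr_ge0.
Qed.

(* [- ln w = - 2 ln (sqrt w) >= 2 (1 - sqrt w)]; unlike [- ln w], the right-hand
   side is integrable as soon as [w] is. *)
Lemma npoweR_ge_expR s w : (0 <= s)%R -> (0 <= w)%R ->
  (expR (s * (2 * (1 - Num.sqrt w))))%:E <= npoweR w%:E s.
Proof.
move=> s0; rewrite /npoweR/= le_eqVlt => /predU1P[<-|w0].
  have [->|sn0] := eqVneq s 0%R; first by rewrite powRr0 inve1 mul0r expR0.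
  by rewrite powR0// inve0 leey.
rewrite inver powR_eq0 gt_eqF//= lee_fin -powRN /powR gt_eqF// ler_expR.
rewrite mulNr -mulrN ler_wpM2l//.
have q0 : (0 < Num.sqrt w)%R by rewrite sqrtr_gt0.
rewrite -[in leRHS](sqr_sqrtr (ltW w0)) lnXn// -[in leRHS]mulr_natl.
have := @le_ln1Dx _ (Num.sqrt w - 1)%R.
rewrite [(1 + _)%R]addrC subrK => lnq.
have {}lnq := lnq ltac:(lra).
lra.
Qed.

End real_inequalities.

(** * Lower bounds on the tilted integral, uniform in the exponent [s] *)

Section entropy_gap.
Context d (T : measurableType d) (R : realType) (mu : probability T R).
Variables (l : T -> R) (W : T -> \bar R) (K : R).
Hypotheses (ml : measurable_fun [set: T] l).
Hypothesis il : mu.-integrable [set: T] (EFin \o l).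
Hypothesis lK : \int[mu]_x (l x)%:E = (- K)%:E.
Hypothesis evW : evars mu W.

Let w x : R := fine (W x).

Let mW : measurable_fun [set: T] W. Proof. by case: evW. Qed.
Let W0 x : 0 <= W x. Proof. by case: evW. Qed.
Let w0 x : (0 <= w x)%R. Proof. by rewrite fine_ge0. Qed.
Let mw : measurable_fun [set: T] w.
Proof. by apply: measurableT_comp mW. Qed.

Let iW : mu.-integrable [set: T] W.
Proof.
apply/integrableP; split => //; under eq_integral do rewrite gee0_abs//.
by case: evW => _ _ /le_lt_trans; apply; rewrite ltry.
Qed.

Let Ww : {ae mu, forall x, W x = (w x)%:E}.
Proof.
by apply: filterS (integrable_ae measurableT iW) => x /(_ I) ?; rewrite fineK.
Qed.

Let iw : mu.-integrable [set: T] (EFin \o w).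
Proof.
apply/integrableP; split; first exact/measurable_EFinP.
have [_] := integrableP _ _ _ iW; congr (_ < _).
apply: ae_eq_integral => //; [exact: measurableT_comp| |].
  by apply/measurableT_comp => //; exact/measurable_EFinP.
by apply: filterS Ww => x /= -> _.
Qed.

Let q x : R := Num.sqrt (w x).
Let mq : measurable_fun [set: T] q.
Proof.
apply: (measurableT_comp _ mw); apply: continuous_measurable_fun.
exact: sqrt_continuous.
Qed.

Let iq : mu.-integrable [set: T] (EFin \o q).
Proof.
apply: (@le_integrable _ _ _ mu _ measurableT _ (EFin \o (fun x => 1 + w x)%R)).
- exact/measurable_EFinP.
- move=> x _ /=; rewrite lee_fin !ger0_norm ?addr_ge0 ?sqrtr_ge0//.
  have := sqr_sqrtr (w0 x); rewrite -/(q x) => <-.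
  by have := sqr_ge0 (q x - 1); nra.
- have := integrableD measurableT (finite_measure_integrable_cst mu 1 measurableT) iw.
  exact.
Qed.

Let p x : R := Num.max (l x + K)%R 0%R.
Let mp : measurable_fun [set: T] p.
Proof. by apply: measurable_maxr => //; exact: measurable_funD. Qed.

Let ip : mu.-integrable [set: T] (EFin \o p).
Proof.
have iK := finite_measure_integrable_cst mu K measurableT.
apply: (@le_integrable _ _ _ mu _ measurableT _ (EFin \o (l \+ cst K)%R)).
- exact/measurable_EFinP.
- move=> x _ /=; rewrite lee_fin /p ger0_norm ?le_max ?lexx ?orbT//.
  by rewrite ge_max normr_ge0 ler_norm.
- exact: (integrableD measurableT il iK).
Qed.

(** Since [l + K] has mean zero, [c] is half the mean absolute deviation of [l]. The number [a] is a
    finite lower substitute for the mean of [- ln W], and [b] is the mean of [W]. *)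
Let c : R := fine (\int[mu]_x (p x)%:E).
Let a : R := (2 * (1 - fine (\int[mu]_x (q x)%:E)))%R.
Let b : R := fine (\int[mu]_x (w x)%:E).

Let cE : \int[mu]_x (p x)%:E = c%:E.
Proof. by rewrite fineK//; exact: integrable_fin_num ip. Qed.

Let b1 : (b <= 1)%R.
Proof.
rewrite -lee_fin fineK; last exact: integrable_fin_num iw.
case: evW => _ _; apply: le_trans; apply: ae_le_integral => //.
  exact/measurable_EFinP.
by apply: filterS Ww => x ->.
Qed.

(** Integrates [expR_tilt_lower] at [l + K]: the linear term [l + K] vanishes, its positive part
    contributes [e * c], and [b <= 1] bounds the loss by [e * s]. *)
Lemma tilted_lower_bound (e s : R) : (0 <= e)%R -> (0 <= s)%R ->
  (expR (- K) * (1 + e * c + s * (a - e) - e ^+ 2))%:E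
  <= \int[mu]_x ((expR (l x))%:E * npoweR (W x) s).
Proof.
move=> e0 s0.
(* All constant terms of the pointwise bound are gathered into [g0]; [G] is then this constant plus
   [l] and multiples of [q], [p] and [w]. *)
have [g0 g0E] : exists g0 : R, g0 = (1 + K + s * 2 - e ^+ 2)%R by eexists.
pose G := (cst g0 \+ (l \+ ((fun x => (- (s * 2)) * q x) \+
  ((fun x => e * p x) \+ (fun x => (- (e * s)) * w x)))))%R.
have iZ k f : mu.-integrable [set: T] (EFin \o f) ->
    mu.-integrable [set: T] (EFin \o (fun x => k * f x)%R).
  by move=> fi; have := integrableZl measurableT k fi.
have iD (f g : T -> R) : mu.-integrable [set: T] (EFin \o f) ->
    mu.-integrable [set: T] (EFin \o g) ->
    mu.-integrable [set: T] (EFin \o (f \+ g)%R).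
  by move=> fi gi; have := integrableD measurableT fi gi.
have iC k : mu.-integrable [set: T] (EFin \o cst k).
  exact: finite_measure_integrable_cst.
have IC k : \int[mu]_x k%:E = k%:E.
  rewrite [LHS](integral_cst mu measurableT k%:E).
  by rewrite [X in _ * X]probability_setT mule1.
have i1 := iZ (- (e * s))%R _ iw.
have i2 := iD _ _ (iZ e _ ip) i1.
have i3 := iD _ _ (iZ (- (s * 2))%R _ iq) i2.
have i4 := iD _ _ il i3.
have iG : mu.-integrable [set: T] (EFin \o G) by exact: iD.
have GE : \int[mu]_x (G x)%:E =
    (1 + e * c + s * (a - e * b) - e ^+ 2)%:E.
  under eq_integral do rewrite /G/= EFinD.
  rewrite (integralD measurableT (iC _) i4).
  under [X in _ + X]eq_integral do rewrite /= EFinD.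
  rewrite (integralD measurableT il i3).
  under [X in _ + (_ + X)]eq_integral do rewrite /= EFinD.
  rewrite (integralD measurableT (iZ (- (s * 2))%R _ iq) i2).
  under [X in _ + (_ + (_ + X))]eq_integral do rewrite /= EFinD.
  rewrite (integralD measurableT (iZ e _ ip) i1).
  under [X in _ + (_ + (X + _))]eq_integral do rewrite /= EFinM.
  under [X in _ + (_ + (_ + (X + _)))]eq_integral do rewrite /= EFinM.
  under [X in _ + (_ + (_ + (_ + X)))]eq_integral do rewrite /= EFinM.
  rewrite !integralZl//.
  rewrite cE lK IC.
  have -> : \int[mu]_x (q x)%:E = (1 - a / 2)%:E.
    rewrite -[LHS]fineK; last exact: integrable_fin_num iq.
    by rewrite /a; congr EFin; field.
  have -> : \int[mu]_x (w x)%:E = b%:E.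
    by rewrite fineK//; exact: integrable_fin_num iw.
  rewrite -!EFinM -!EFinD; congr EFin; rewrite g0E; by field.
have le1 : (expR (- K) * (1 + e * c + s * (a - e) - e ^+ 2))%:E <=
    \int[mu]_x (expR (- K) * G x)%:E.
  under eq_integral do rewrite EFinM.
  rewrite integralZl// GE -EFinM lee_fin ler_wpM2l ?expR_ge0//.
  rewrite lerD2r lerD2l ler_wpM2l// lerD2l lerN2 -[leRHS]mulr1.
  by rewrite ler_wpM2l.
apply: (le_trans le1).
apply: ae_le_integral.
- apply/measurable_EFinP; apply: measurable_funM => //.
  by have /measurable_EFinP := measurable_int _ iG.
- apply: emeasurable_funM.
    by apply/measurable_EFinP; exact: measurableT_comp.
  exact: (measurableT_comp (measurable_npoweR s)).
apply: filterS Ww => x ->.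
apply: (@le_trans _ _ ((expR (l x))%:E * (expR (s * (2 * (1 - q x))))%:E)).
  (* Splitting off [expR (- K)] leaves the exponent [l + K + s * 2 (1 - q)] of [expR_tilt_lower]. *)
  rewrite -EFinM lee_fin -expRD -[in leRHS](addKr K (l x)) -addrA expRD.
  rewrite ler_wpM2l ?expR_ge0//.
  rewrite [(K + l x)%R]addrC.
  apply: le_trans (expR_tilt_lower (l x + K)%R e0 s0 (w0 x)).
  rewrite le_eqVlt; apply/orP; left; apply/eqP.
  by rewrite /G/= -/(q x) -/(p x) g0E; ring.
by rewrite lee_wpmul2l ?lee_fin ?expR_ge0// npoweR_ge_expR.
Qed.

(** Expands the square with [q ^+ 2 = w]. Nonnegativity of the left side gives [1 - b <= a], hence
    [0 <= a]; if [a = 0], then [b = 1], the left side vanishes and [W = 1] a.e. *)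
Let sqE : \int[mu]_x ((1 - q x) ^+ 2)%:E = (a - (1 - b))%:E.
Proof.
have iZ : mu.-integrable [set: T] (EFin \o (fun x => - 2 * q x)%R).
  by have := integrableZl measurableT (- 2)%R iq.
have iqw : mu.-integrable [set: T] (EFin \o (fun x => - 2 * q x + w x)%R).
  by have := integrableD measurableT iZ iw.
have i1 := finite_measure_integrable_cst mu 1%R measurableT.
transitivity (\int[mu]_x ((cst 1 x)%:E + (- 2 * q x + w x)%:E)).
  apply: eq_integral => x _; rewrite -EFinD; congr EFin.
  by have := sqr_sqrtr (w0 x); rewrite -/(q x) => <-; rewrite /cst; ring.
rewrite (integralD measurableT i1 iqw).
under [X in _ + X]eq_integral do rewrite /= EFinD.
rewrite (integralD measurableT iZ iw).
under [X in _ + (X + _)]eq_integral do rewrite /= EFinM.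
rewrite integralZl// [X in X + _](integral_cst mu measurableT 1%:E).
rewrite [X in _ * X + _]probability_setT mule1.
have -> : \int[mu]_x (q x)%:E = (1 - a / 2)%:E.
  rewrite -[LHS]fineK; last exact: integrable_fin_num iq.
  by rewrite /a; congr EFin; field.
have -> : \int[mu]_x (w x)%:E = b%:E.
  by rewrite fineK//; exact: integrable_fin_num iw.
by rewrite -!EFinM -!EFinD; congr EFin; field.
Qed.

Let a_ge1b : (1 - b <= a)%R.
Proof.
rewrite -subr_ge0 -lee_fin -sqE integral_ge0// => x _.
by rewrite lee_fin sqr_ge0.
Qed.

Let a_ge0 : (0 <= a)%R.
Proof. by apply: le_trans a_ge1b; rewrite subr_ge0. Qed.

(** The case [e = 0], where [a >= 0] suffices: the non-strict bound, which allows a constant [l]. *)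
Lemma tilted_lower_bound0 (s : R) : (0 <= s)%R ->
  (expR (- K))%:E <= \int[mu]_x ((expR (l x))%:E * npoweR (W x) s).
Proof.
move=> s0; apply: le_trans (tilted_lower_bound (lexx 0%R) s0).
rewrite lee_fin -[leLHS]mulr1 ler_wpM2l ?expR_ge0//.
by rewrite expr2 !mul0r !subr0 addr0 lerDl mulr_ge0.
Qed.

Let W1 : a = 0%R -> {ae mu, forall x, W x = 1}.
Proof.
move=> a0; have b1' : b = 1%R.
  by apply: le_anti; rewrite b1/=; move: a_ge1b; rewrite a0 subr_le0.
have : \int[mu]_x `|((1 - q x) ^+ 2)%:E| = 0.
  under eq_integral do rewrite gee0_abs ?lee_fin ?sqr_ge0//.
  by rewrite sqE a0 b1' subrr subr0.
have mf : measurable_fun [set: T] (fun x => ((1 - q x) ^+ 2)%:E).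
  by apply/measurable_EFinP; apply: measurable_funX; exact: measurable_funB.
move/(ae_eq_integral_abs mu measurableT mf) => q1.
apply: filterS2 q1 Ww => x /(_ I)/= [] /eqP; rewrite sqrf_eq0 subr_eq0 => /eqP q1 ->.
by rewrite -(sqr_sqrtr (w0 x)) -/(q x) -q1 expr1n.
Qed.

Let c_gt0 : 0 < mu [set x | (- K < l x)%R] -> (0 < c)%R.
Proof.
move=> Al; have c0 : (0 <= c)%R.
  by rewrite fine_ge0// integral_ge0// => x _; rewrite lee_fin /p le_max lexx orbT.
rewrite lt_neqAle c0 andbT; apply/eqP => c00.
have : \int[mu]_x `|(p x)%:E| = 0.
  under eq_integral do rewrite gee0_abs ?lee_fin ?le_max ?lexx ?orbT//.
  by rewrite cE -c00.
have mpE : measurable_fun [set: T] (fun x => (p x)%:E) by exact/measurable_EFinP.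
move/(ae_eq_integral_abs mu measurableT mpE) => [N [mN N0 sN]].
move: Al; rewrite lt_neqAle eq_sym measure_ge0 andbT => /eqP; apply.
apply: (@subset_measure0 _ _ _ mu _ N) => //.
  rewrite (_ : [set x | _] = l @^-1` `]- K, +oo[)%R; last first.
    by apply/seteqP; split => x /=; rewrite in_itv/= andbT.
  by rewrite -[X in measurable X]setTI; apply: ml.
move=> x /= xl; apply: sN => /= /(_ I) [].
rewrite /p => /eqP; apply/negP; rewrite gt_eqF// lt_max; apply/orP; left.
by rewrite -ltrBlDr sub0r.
Qed.

(** A choice of [e] independent of [s] gains [e * c - e ^+ 2], which is at least [e ^+ 2] when
    [e <= c / 2]; this gives [K' = K - ln (1 + e ^+ 2)]. *)
Lemma entropy_gap : 0 < mu [set x | (- K < l x)%R] ->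
  exists2 K' : R, (K' < K)%R & forall s : R, (0 <= s)%R ->
    (expR (- K'))%:E <= \int[mu]_x ((expR (l x))%:E * npoweR (W x) s).
Proof.
move=> /c_gt0 c0.
suff [e e0 ce] : exists2 e, (0 < e)%R & (e <= c / 2)%R /\ forall s : R, (0 <= s)%R ->
    (expR (- K) * (1 + e * c - e ^+ 2))%:E
    <= \int[mu]_x ((expR (l x))%:E * npoweR (W x) s).
  have e20 : (0 < e ^+ 2)%R by rewrite exprn_gt0.
  exists (K - ln (1 + e ^+ 2))%R.
    by rewrite gtrDl oppr_lt0 ln_gt0// ltrDl.
  move=> s s0; case: ce => ec /(_ _ s0); apply: le_trans.
  rewrite opprB addrC expRD lnK ?posrE ?addr_gt0// lee_fin ler_wpM2l ?expR_ge0//.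
  rewrite -addrA lerD2l; nra.
have [a0|a0] := leP a 0%R; last first.
  (* If [a > 0], then [e <= a] makes the term [s * (a - e)] nonnegative for every [s]. *)
  exists (Num.min a (c / 2))%R; first by rewrite lt_min a0 divr_gt0.
  split; first by rewrite ge_min lexx orbT.
  move=> s s0; set e := Num.min _ _.
  have e0 : (0 <= e)%R by rewrite le_min a_ge0 divr_ge0// ltW.
  apply: le_trans (tilted_lower_bound e0 s0).
  rewrite lee_fin ler_wpM2l ?expR_ge0// lerD2r lerDl mulr_ge0// subr_ge0.
  by rewrite ge_min lexx.
have {}a0 : a = 0%R by apply: le_anti; rewrite a0 a_ge0.
(* If [a = 0], then [W = 1] a.e., the integral does not depend on [s], and the bound at exponent [0]
   serves for all [s]. *)
exists (c / 2)%R; first by rewrite divr_gt0.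
split => // s s0; have e0 : (0 <= c / 2)%R by rewrite divr_ge0// ltW.
have := tilted_lower_bound e0 (lexx 0%R); rewrite mul0r addr0 => /le_trans; apply.
have mel : measurable_fun [set: T] (fun x => (expR (l x))%:E).
  by apply/measurable_EFinP; exact: measurableT_comp.
have mnp t : measurable_fun [set: T] (fun x => npoweR (W x) t).
  exact: (measurableT_comp (measurable_npoweR t)).
apply: ae_le_integral; [exact: emeasurable_funM..|].
by apply: filterS (W1 a0) => x ->; rewrite /npoweR !poweR1r.
Qed.

End entropy_gap.

(** * Cylinders, and measures restricted to the first [n] coordinates *)

Section cylinders.
Context d (X : measurableType d).

Definition cylinder (n : nat) (A : nat -> set X) : set (nat -> X) :=
  [set w | forall i, (i < n)%N -> A i (w i)].

Lemma measurable_coord (I : set nat) i : I i ->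
  measurable_fun [set: g_sigma_algebraType (@coord_sets _ X I)]
    (fun w : g_sigma_algebraType (@coord_sets _ X I) => w i).
Proof.
move=> Ii _ B mB; apply: sub_sigma_algebra; exists i => //.
by exists B.
Qed.

Lemma measurable_subfamily (I J : set nat) (A : set (nat -> X)) : I `<=` J ->
  measurable (A : set (g_sigma_algebraType (@coord_sets _ X I))) ->
  measurable (A : set (g_sigma_algebraType (@coord_sets _ X J))).
Proof.
move=> IJ; apply: sub_sigma_algebra2 => S [i Ii SE].
by exists i => //; exact: IJ.
Qed.

Lemma measurable_id_subfamily (I J : set nat) : I `<=` J ->
  measurable_fun [set: g_sigma_algebraType (@coord_sets _ X J)]
    (fun w => w : g_sigma_algebraType (@coord_sets _ X I)).
Proof. by move=> IJ _ B mB; rewrite setTI; exact: measurable_subfamily mB. Qed.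

Lemma measurable_fun_subfamily d' (Y : measurableType d') (I J : set nat)
    (f : (nat -> X) -> Y) : I `<=` J ->
  measurable_fun [set: g_sigma_algebraType (@coord_sets _ X I)] f ->
  measurable_fun [set: g_sigma_algebraType (@coord_sets _ X J)] f.
Proof.
move=> IJ mf; exact: (measurableT_comp mf (measurable_id_subfamily IJ)).
Qed.

Lemma measurable_cylinder (I : set nat) n A : `I_n `<=` I ->
  (forall i, measurable (A i)) ->
  measurable (cylinder n A : set (g_sigma_algebraType (@coord_sets _ X I))).
Proof.
move=> nI mA.
rewrite (_ : cylinder n A = \bigcap_(i in `I_n) ((fun w => w i) @^-1` A i))//.
apply: fin_bigcap_measurable; first exact: finite_II.
move=> i ni.
rewrite -[X in measurable X]setTI; apply: measurable_coord => //.
exact: nI.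
Qed.

Context (R : realType).

(** Cylinders with measurable sides are stable under intersection, include the whole space, and
    generate a sigma-algebra containing F_n; uniqueness of finite measures applies. *)
Lemma eq_measure_filtration (m1 m2 : {finite_measure set (trajectories X) -> \bar R}) n :
  (forall A, (forall i, measurable (A i)) -> m1 (cylinder n A) = m2 (cylinder n A)) ->
  forall S : set (filtration X n), measurable S -> m1 S = m2 S.
Proof.
move=> m12 S mS.
pose G := [set S | exists2 A, (forall i, measurable (A i)) & S = cylinder n A].
pose H := [set S | G S /\ S `<=` [set: nat -> X]].
have mG : G `<=` @measurable _ (trajectories X).
  by move=> _ [A mA ->]; exact: measurable_cylinder.
have cT : [set: nat -> X] = cylinder n (fun=> setT) by apply/seteqP; split.
apply: (@g_sigma_algebra_measure_unique_trace _ R (trajectories X) G setT _ _ _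
  m1 m2) => //.
- by move=> A [/mG].
- move=> _ _ [[A mA ->] _] [[B mB ->] _]; split => //.
  exists (fun i => A i `&` B i); first by move=> i; exact: measurableI.
  apply/seteqP; split => w /=; first by move=> [wA wB] i i_n; split; [exact: wA|exact: wB].
  by move=> wAB; split => i /wAB[].
- by rewrite cT; exact: m12.
- by move=> _ [[A mA ->] _]; exact: m12.
- by rewrite ltey_eq fin_num_measure.
- move: S mS; apply: sub_sigma_algebra2 => _ [i /= i_n [B mB <-]]; split => //.
  exists (fun j => if j == i then B else setT).
    by move=> j; case: ifPn.
  apply/seteqP; split => w /=.
    by move=> [_ wB] j _; case: eqP => // ->.
  by move=> /(_ i i_n); rewrite eqxx.
Qed.

(** The identity map onto the coarser F_n is measurable, and the push-forwards of the two measures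
    along it coincide. *)
Lemma eq_integral_filtration (m1 m2 : {measure set (trajectories X) -> \bar R}) n
    (f : (nat -> X) -> \bar R) :
  (forall S : set (filtration X n), measurable S -> m1 S = m2 S) ->
  measurable_fun [set: filtration X n] f -> (forall w, 0 <= f w) ->
  \int[m1]_w f w = \int[m2]_w f w.
Proof.
move=> m12 mf f0.
have nT : `I_n `<=` [set: nat] by [].
have mid := measurable_id_subfamily nT.
have E (m : {measure set (trajectories X) -> \bar R}) :
    \int[m]_w f w =
    \int[pushforward m (fun w : trajectories X => w : filtration X n)]_w f w.
  by rewrite (ge0_integral_pushforward mid).
rewrite !E; apply: eq_measure_integral => S mS _.
exact: m12.
Qed.

End cylinders.

(** * Integrals of coordinate functions and of products under the i.i.d. law *)

Section iid_integrals.
Context d (X : measurableType d) (R : realType).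
Variables (P : probability X R) (PP : probability (trajectories X) R).
Hypothesis hPP : is_iid_product P PP.

Let mcoord i : measurable_fun [set: trajectories X] (fun w : trajectories X => w i).
Proof. exact: measurable_coord. Qed.

Lemma coord_law i B : measurable B -> PP ((fun w => w i) @^-1` B) = P B.
Proof.
move=> mB; pose A j := if j == i then B else setT.
have mA j : measurable (A j) by rewrite /A; case: ifPn.
have -> : (fun w => w i) @^-1` B = [set w | forall j, (j < i.+1)%N -> A j (w j)].
  apply/seteqP; split => w /=; first by move=> wB j _; rewrite /A; case: eqP => // ->.
  by move=> /(_ i (ltnSn i)); rewrite /A eqxx.
rewrite hPP// (bigD1 ord_max)//= big1 ?mule1; first by rewrite /A eqxx.
move=> j; rewrite -val_eqE/= /A => /negbTE ->; exact: probability_setT.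
Qed.

Lemma ge0_integral_coord i (f : X -> \bar R) : measurable_fun [set: X] f ->
  (forall x, 0 <= f x) -> \int[PP]_w f (w i) = \int[P]_x f x.
Proof.
move=> mf f0.
rewrite -[LHS](@ge0_integral_pushforward _ _ _ _ _ _ (mcoord i) PP setT f)//.
by apply: eq_measure_integral => B mB _; exact: coord_law.
Qed.

Lemma integral_coord i (f : X -> \bar R) : measurable_fun [set: X] f ->
  \int[PP]_w f (w i) = \int[P]_x f x.
Proof.
move=> mf; rewrite integralE [RHS]integralE; congr (_ - _).
  rewrite -(ge0_integral_coord i (measurable_funepos mf))//.
  by apply: eq_integral => w _; rewrite !funeposE.
rewrite -(ge0_integral_coord i (measurable_funeneg mf))//.
by apply: eq_integral => w _; rewrite !funenegE.
Qed.

Lemma integrable_coord i (f : X -> \bar R) : P.-integrable [set: X] f ->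
  PP.-integrable [set: trajectories X] (fun w => f (w i)).
Proof.
move=> /integrableP[mf fi]; apply/integrableP; split.
  exact: measurableT_comp mf (mcoord i).
rewrite (ge0_integral_coord i (f := fun x => `|f x|))//.
exact: measurableT_comp.
Qed.

Variable g : nat -> X -> \bar R.
Hypotheses (mg : forall i, measurable_fun [set: X] (g i))
  (g0 : forall i x, 0 <= g i x) (gfin : forall i, \int[P]_x g i x < +oo).

Let Pg k (w : trajectories X) := \prod_(i < k) g i (w i).

Let mPg k : measurable_fun [set: trajectories X] (Pg k).
Proof.
elim: k => [|k IH].
  rewrite (_ : Pg 0 = cst 1)//; apply/funext => w; exact: big_ord0.
rewrite (_ : Pg k.+1 = fun w => Pg k w * g k (w k)).
  by apply: emeasurable_funM => //; exact: measurableT_comp (mcoord k).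
by apply/funext => w; rewrite /Pg big_ord_recr.
Qed.

Let Pg0 k w : 0 <= Pg k w.
Proof. by apply: prode_ge0. Qed.

(* By induction on [k]: replacing the indicator of [A 0] at coordinate [k] by
   [g k] only uses that both sides are measures in the set [A 0]. *)
Lemma integral_prod_cylinder k m (A : nat -> set X) :
  (forall i, measurable (A i)) ->
  \int[PP]_(w in [set w | forall i, (i < m)%N -> A i (w (k + i)%N)])
      \prod_(i < k) g i (w i) =
  \prod_(i < k) \int[P]_x g i x * \prod_(i < m) P (A i).
Proof.
elim: k m A => [|k IH] m A mA.
  under eq_integral do rewrite big_ord0.
  rewrite big_ord0 mul1e -hPP//.
  rewrite [LHS](integral_cst PP _ 1) ?mul1e//.
  exact: measurable_cylinder.
set S := [set w | _].
have mS : measurable (S : set (trajectories X)).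
  rewrite (_ : S = cylinder (k.+1 + m)
      (fun j => if (j <= k)%N then setT else A (j - k.+1)%N)).
    by apply: measurable_cylinder => // i; case: ifPn.
  apply/seteqP; split => w /= H i im.
    case: leqP => // ki.
    have := H (i - k.+1)%N; rewrite subnKC//; apply.
    by rewrite ltn_subLR.
  have := H (k.+1 + i)%N; rewrite ltn_add2l => /(_ im).
  by rewrite ifF ?addKn//; apply/negbTE; rewrite -ltnNge addSn ltnS leq_addr.
pose H := Pg k \_ S.
have mH : measurable_fun [set: trajectories X] H.
  by apply/(measurable_restrictT _ mS); exact: measurable_funTS.
have H0 w : 0 <= H w by rewrite /H patchE; case: ifPn.
pose c := \prod_(i < k) \int[P]_x g i x * \prod_(i < m) P (A i).
have c0 : 0 <= c.
  by rewrite mule_ge0// prode_ge0// => i; rewrite integral_ge0.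
have cfin : c \is a fin_num.
  rewrite fin_numM// prode_fin_num// => i _.
    by rewrite ge0_fin_numE ?integral_ge0.
  exact: fin_num_measure.
have HB B : measurable B -> \int[PP]_(w in (fun w => w k) @^-1` B) H w = c * P B.
  move=> mB; have mkB : measurable ((fun w : trajectories X => w k) @^-1` B).
    by rewrite -[X in measurable X]setTI; exact: mcoord.
  rewrite -integral_mkcondr.
  (* The induction hypothesis is used with one more side: [B] at coordinate [k], followed by the old
     sides shifted by one. *)
  have := IH m.+1 (fun j => if j is j'.+1 then A j' else B).
  rewrite [X in _ * X]big_ord_recl/= [in X in _ * X]muleC muleA => <-; last by case.
  congr integral; apply/seteqP; split => w /=.
    by move=> [wB wS] [|i]; rewrite ?addn0// ltnS addnS -addSn => /wS.
  move=> wS; split; first by have := wS 0%N; rewrite addn0; exact.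
  by move=> i im; have := wS i.+1; rewrite addnS -addSn; exact.
have Hfin : \int[PP]_w H w < +oo.
  have := HB _ measurableT; rewrite preimage_setT => ->.
  by rewrite ltey_eq fin_numM ?fin_num_measure.
transitivity (\int[PP]_w (g k (w k) * H w)).
  rewrite integral_mkcond; apply: eq_integral => w _.
  rewrite /H !patchE; case: ifPn => _; last by rewrite mule0.
  by rewrite big_ord_recr/= muleC.
rewrite -(integral_weighted mH H0 Hfin (h := fun w => g k (w k)))//; last first.
  exact: measurableT_comp (mcoord k).
(* The measure with density [H], pushed forward along coordinate [k], is [c] times [P] by [HB];
   integrating [g k] against it gives the new factor. *)
rewrite -[LHS](@ge0_integral_pushforward _ _ _ _ _ _ (mcoord k) _ setT (g k))//.
have fc0 : (0 <= fine c)%R by rewrite fine_ge0.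
rewrite (eq_measure_integral (mscale (NngNum fc0) P)); last first.
  move=> B mB _; rewrite [LHS](HB _ mB); congr (_ * _).
  exact/esym/fineK.
rewrite ge0_integral_mscale//.
have -> : ((NngNum fc0)%:num)%:E = c by exact: fineK.
rewrite /c big_ord_recr/=.
by rewrite [RHS]muleAC.
Qed.

Lemma integral_prod_coord k :
  \int[PP]_w \prod_(i < k) g i (w i) = \prod_(i < k) \int[P]_x g i x.
Proof.
have := integral_prod_cylinder k 0 (fun i => @measurableT _ X).
rewrite [in RHS]big_ord0 mule1 => <-; congr integral.
by apply/seteqP; split.
Qed.

End iid_integrals.

(** * Likelihood ratio and wealth on path space *)

Section path.
Context d (X : measurableType d) (R : realType).
Variables (P0 P1 : probability X R) (PP0 PP1 : probability (trajectories X) R).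
Hypotheses (hPP0 : is_iid_product P0 PP0) (hPP1 : is_iid_product P1 PP1).
Variable l : X -> R.
Hypothesis ml : measurable_fun [set: X] l.
Hypothesis P1E : forall A, measurable A ->
  P1 A = \int[P0]_(x in A) (expR (l x))%:E.

Let g x := (expR (l x))%:E.
Let mg : measurable_fun [set: X] g.
Proof. by apply/measurable_EFinP; exact: measurableT_comp. Qed.
Let g0 x : 0 <= g x. Proof. by rewrite lee_fin expR_ge0. Qed.

Let L t (w : trajectories X) : R := (\sum_(i < t) l (w i))%R.

Let mL t : measurable_fun [set: trajectories X] (L t).
Proof.
elim: t => [|t IH].
  rewrite (_ : L 0 = cst 0%R)//; apply/funext => w; exact: big_ord0.
rewrite (_ : L t.+1 = fun w => (L t w + l (w t))%R).
  apply: measurable_funD => //; apply: (measurableT_comp ml).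
  exact: measurable_coord.
by apply/funext => w; rewrite /L big_ord_recr.
Qed.

Let rhoE t w : (expR (L t w))%:E = \prod_(i < t) g (w i).
Proof.
elim: t => [|t IH]; first by rewrite /L !big_ord0 expR0.
by rewrite /L !big_ord_recr/= expRD EFinM -IH.
Qed.

(** On a cylinder the density integrates to a product of integrals of [g] over the sides, that is,
    of P1-masses. So PP1 and the weighted PP0 agree on cylinders, hence on F_t. *)
Lemma integral_path_density t (f : (nat -> X) -> \bar R) :
  measurable_fun [set: filtration X t] f -> (forall w, 0 <= f w) ->
  \int[PP1]_w f w = \int[PP0]_w (f w * (expR (L t w))%:E).
Proof.
move=> mf f0.
have mrho : measurable_fun [set: trajectories X] (fun w => (expR (L t w))%:E).
  by apply/measurable_EFinP; exact: measurableT_comp.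
have rho0 w : 0 <= (expR (L t w))%:E by rewrite lee_fin expR_ge0.
have gA A : measurable A -> \int[P0]_x (g \_ A) x = P1 A.
  by move=> mA; rewrite -integral_mkcond P1E.
have gAfin A : measurable A -> \int[P0]_x (g \_ A) x < +oo.
  by move=> mA; rewrite gA// ltey_eq fin_num_measure.
have cylE A : (forall i, measurable (A i)) -> PP1 (cylinder t A) =
    \int[PP0]_(w in cylinder t A) (expR (L t w))%:E.
  move=> mA; rewrite [LHS]hPP1//.
  under eq_bigr do rewrite -gA//.
  rewrite -(integral_prod_coord hPP0 (g := fun i => g \_ (A i))); first last.
  - by move=> i; exact: gAfin.
  - by move=> i x; rewrite patchE; case: ifPn.
  - by move=> i; apply/(measurable_restrictT _ (mA i)); exact: measurable_funTS.
  rewrite [RHS]integral_mkcond; apply: eq_integral => w _.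
  rewrite patchE; case: ifPn => [/set_mem wA|].
    by rewrite rhoE; apply: eq_bigr => i _; rewrite patchE mem_set//; exact: wA.
  rewrite notin_setE => /existsNP[i /not_implyP[it wA]].
  by rewrite (bigD1 (Ordinal it))//= patchE memNset// mul0e.
have rhofin : \int[PP0]_w (expR (L t w))%:E < +oo.
  have := @cylE (fun=> setT) (fun=> measurableT).
  have -> : cylinder t (fun=> [set: X]) = setT by apply/seteqP; split.
  by move=> <-; rewrite ltey_eq fin_num_measure.
have nT : `I_t `<=` [set: nat] by [].
have mf' := measurable_fun_subfamily nT mf.
rewrite -(integral_weighted mrho rho0 rhofin mf' f0).
by apply: (@eq_integral_filtration _ _ _ _ _ t) => //; exact: eq_measure_filtration.
Qed.

Section wealth.
Variables (E : nat -> (nat -> X) -> \bar R).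
Hypothesis hE : betting_sequence PP0 E.

Lemma wealth_ge0 t w : 0 <= wealth E t w.
Proof. by apply: prode_ge0 => n; have [] := hE n. Qed.

Lemma wealthS t w : wealth E t.+1 w = wealth E t w * E t w.
Proof. by rewrite /wealth big_ord_recr. Qed.

Lemma measurable_wealth t : measurable_fun [set: filtration X t] (wealth E t).
Proof.
elim: t => [|t IH].
  rewrite (_ : wealth E 0 = cst 1)//; apply/funext => w; exact: big_ord0.
rewrite (_ : wealth E t.+1 = fun w => wealth E t w * E t w); last first.
  by apply/funext => w; rewrite wealthS.
apply: emeasurable_funM; last by have [] := hE t.
have tS : `I_t `<=` `I_t.+1 by move=> i /= /ltnW.
have IH' := measurable_fun_subfamily tS IH.
exact: IH'.
Qed.

(** By induction on [t]: since [wealth E t] is F_t-measurable, the next bet can be replaced under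
    the integral by its conditional expectation [Z], which is at most 1 a.s. *)
Lemma evars_wealth t : evars PP0 (wealth E t).
Proof.
have nT k : `I_k `<=` [set: nat] by [].
have mW k := measurable_fun_subfamily (nT k) (@measurable_wealth k).
split; [exact: mW|exact: wealth_ge0|].
elim: t => [|t IH].
  rewrite (eq_integral (cst 1)); last by move=> w _; rewrite /wealth big_ord0.
  by rewrite integral_cst// mul1e [leLHS]probability_setT.
have [mEt Et0 [Z [[mZ Z0 ZE] Z1]]] := hE t.
have mEt' := measurable_fun_subfamily (nT _) mEt.
have mZ' := measurable_fun_subfamily (nT _) mZ.
have mW' := mW t.
have Zfin : \int[PP0]_w Z w < +oo.
  apply: (@le_lt_trans _ _ (\int[PP0]_w cst 1 w)); first exact: ae_le_integral.
  by rewrite integral_cst// mul1e [ltLHS]probability_setT ltry.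
have Efin : \int[PP0]_w E t w < +oo.
  by have := ZE setT measurableT => <-.
under eq_integral do rewrite wealthS.
rewrite -(integral_weighted mEt' Et0 Efin mW' (wealth_ge0 t)).
(* The measures with densities [E t] and [Z] agree on F_t by the defining property of [Z]. *)
rewrite (@eq_integral_filtration _ _ _ _ (weighted mZ' Z0 Zfin) t)//; first last.
- exact: wealth_ge0.
- exact: measurable_wealth.
- by move=> S mS; exact/esym/ZE.
rewrite (integral_weighted mZ' Z0 Zfin mW' (wealth_ge0 t)).
apply: le_trans IH; apply: ae_le_integral => //.
  exact: emeasurable_funM.
have [N [mN N0 sN]] := Z1; exists N; split => //.
apply: subset_trans sN; apply: subsetC => w /= Zw; rewrite -[leRHS]mule1 lee_wpmul2l//.
exact: wealth_ge0.
Qed.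

End wealth.

(** Applies [entropy_gap] on path space to the log-likelihood [L t], of mean [- (t * K)], and to the
    e-variable [wealth E t]; dividing by [t] gives the rate. *)
Lemma Lambda_path_lt K E t : P0.-integrable [set: X] (EFin \o l) ->
  \int[P0]_x (l x)%:E = (- K)%:E -> 0 < P0 [set x | (- K < l x)%R] ->
  betting_sequence PP0 E -> (0 < t)%N -> Lambda_path PP1 E t < K%:E.
Proof.
move=> il lK Kl hE t0.
have tR : (0 < t%:R^-1 :> R)%R by rewrite invr_gt0 ltr0n.
have iL : PP0.-integrable [set: trajectories X] (EFin \o L t).
  rewrite (_ : EFin \o L t = fun w => \sum_(i < t) (l (w i))%:E).
    apply: integrable_sum => // i _; exact: (integrable_coord hPP0 i il).
  by apply/funext => w /=; rewrite sumEFin.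
have LK : \int[PP0]_w (L t w)%:E = (- (t%:R * K))%:E.
  under eq_integral do rewrite -sumEFin.
  rewrite integral_sum//; last by move=> i; exact: (integrable_coord hPP0 i il).
  under eq_bigr => i _ do rewrite (integral_coord hPP0 i (measurable_int _ il)) lK.
  by rewrite sumEFin sumr_const card_ord mulNrn mulr_natl.
have LKpos : 0 < PP0 [set w | (- (t%:R * K) < L t w)%R].
  have mKl : measurable [set x | (- K < l x)%R].
    rewrite (_ : [set x | _] = l @^-1` `]- K, +oo[)%R; last first.
      by apply/seteqP; split => x /=; rewrite in_itv/= andbT.
    by rewrite -[X in measurable X]setTI; apply: ml.
  (* All of the first [t] coordinates exceed [- K] with probability a product of positive masses,
     and then so does their average. *)
  apply: (@lt_le_trans _ _ (PP0 (cylinder t (fun=> [set x | (- K < l x)%R])))).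
    rewrite [ltRHS]hPP0//; elim/big_ind: _ => // x y; exact: mule_gt0.
  apply: le_measure; rewrite ?inE; first exact: measurable_cylinder.
    rewrite (_ : [set w | _] = L t @^-1` `]- (t%:R * K), +oo[)%R; last first.
      by apply/seteqP; split => x /=; rewrite in_itv/= andbT.
    by rewrite -[X in measurable X]setTI; apply: mL.
  move=> w /= wl.
  have -> : (- (t%:R * K) = \sum_(i < t) - K)%R.
    by rewrite sumr_const card_ord mulNrn mulr_natl.
  (* Positivity of [t] provides a last summand, for which the inequality is strict. *)
  case: t t0 wl {tR iL LK} => // t _ wl.
  rewrite /L !big_ord_recr/=; apply: ler_ltD; last exact: wl.
  by apply: ler_sum => i _; apply/ltW/wl/(ltn_trans (ltn_ord i)).
have [K' K'K gap] := entropy_gap (@mL t) iL LK (evars_wealth hE t) LKpos.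
apply: (@le_lt_trans _ _ (t%:R^-1 * K')%:E); last first.
  by rewrite lte_fin mulrC ltr_pdivrMr ?ltr0n// mulrC.
apply: ge_ereal_sup => _ [s s0 <-].
rewrite -muleN EFinM; apply: lee_wpmul2l; first by rewrite lee_fin ltW.
apply: oppe_lne_le.
apply: le_trans (gap _ s0) _; rewrite (@integral_path_density t).
- by under [leRHS]eq_integral do rewrite muleC.
- exact: measurableT_comp (measurable_npoweR s) (measurable_wealth hE (t := t)).
- by move=> w; exact: npoweR_ge0.
Qed.

End path.

(** * An integrability criterion and logarithm inequalities *)

Lemma integrable_funeneg_lty d (T : measurableType d) (R : realType)
    (mu : {measure set T -> \bar R}) (f : T -> \bar R) :
  measurable_fun [set: T] f -> \int[mu]_x f^\- x < +oo -> \int[mu]_x f x < +oo ->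
  mu.-integrable [set: T] f.
Proof.
move=> mf fn fi; apply/integrableP; split => //.
have fn' : \int[mu]_x f^\- x \is a fin_num by rewrite ge0_fin_numE// integral_ge0.
rewrite -[fun x => _]/(abse \o f) fune_abse ge0_integralD//.
(* With a finite negative part, an infinite positive part would make the integral of [f]
   infinite. *)
- rewrite lte_add_pinfty// ltey; apply/eqP => fpE; move: fi.
  by rewrite integralE fpE -(fineK fn').
- exact: measurable_funepos.
- exact: measurable_funeneg.
Qed.

Lemma ln_eq_subr1 (R : realType) (x : R) : (0 < x)%R -> (ln x = x - 1 -> x = 1)%R.
Proof.
move=> x0 lx; apply/eqP; rewrite -subr_eq0; apply: contraT => x1.
by have := expR_gt1Dx x1; rewrite -lx lnK ?posrE// lx addrC subrK ltxx.
Qed.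

Lemma ln_le_subr1 (R : realType) (x : R) : (0 < x)%R -> (ln x <= x - 1)%R.
Proof.
move=> x0; have := @le_ln1Dx _ (x - 1)%R.
rewrite [(1 + _)%R]addrC subrK; apply; lra.
Qed.

(** * Approximation of [y - 1 - ln y] by roots *)

Section root_defect.
Context (R : realType).
Implicit Types (y : R) (n : nat).

(* The gap in Bernoulli's inequality [(n+1) (y^{1/(n+1)} - 1) <= y - 1]. *)
Definition root_defect n y : R :=
  (y - 1 - n.+1%:R * (y `^ (n.+1%:R^-1) - 1))%R.

Lemma bernoulli n y : (0 <= y)%R -> (1 + n%:R * (y - 1) <= y ^+ n)%R.
Proof.
move=> y0; elim: n => [|n IH]; first by rewrite mul0r addr0 expr0.
have := ler_wpM2l y0 IH; rewrite -exprS; apply: le_trans.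
rewrite -subr_ge0 [leRHS](_ : _ = n%:R * (y - 1) ^+ 2)%R.
  by rewrite mulr_ge0// sqr_ge0.
by rewrite -natr1; ring.
Qed.

Lemma root_defect_ge0 n y : (0 <= y)%R -> (0 <= root_defect n y)%R.
Proof.
move=> y0; have := bernoulli n.+1 (powR_ge0 y n.+1%:R^-1).
rewrite -powR_mulrn ?powR_ge0// -powRrM mulVf ?pnatr_eq0// powRr1//.
by rewrite /root_defect => H; rewrite subr_ge0 lerBrDl.
Qed.

Lemma root_defect_le n y : (0 < y)%R -> (root_defect n y <= y - 1 - ln y)%R.
Proof.
move=> y0; rewrite lerD2l lerN2 /powR gt_eqF//.
have := expR_ge1Dx (n.+1%:R^-1 * ln y)%R; rewrite -lerBrDl => H.
have := ler_wpM2l (ler0n R n.+1) H.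
by rewrite mulrA divff ?pnatr_eq0// mul1r.
Qed.

Lemma root_defect_ge n y : (0 < y)%R ->
  (y - 1 - ln y * expR (n.+1%:R^-1 * ln y) <= root_defect n y)%R.
Proof.
move=> y0; rewrite lerD2l lerN2 /powR gt_eqF//.
set u := (n.+1%:R^-1 * ln y)%R.
have H : (expR u - 1 <= u * expR u)%R.
  have := ler_wpM2r (expR_ge0 u) (expR_ge1Dx (- u)).
  by rewrite expRN mulVf ?gt_eqF ?expR_gt0// mulrDl mul1r mulNr; lra.
have := ler_wpM2l (ler0n R n.+1) H; move/le_trans; apply.
by rewrite mulrA /u mulrA divff ?pnatr_eq0// mul1r.
Qed.

(** For [y > 0] the bounds [root_defect_ge] and [root_defect_le] squeeze the sequence. At [y = 0]
    the defect is exactly [n], matching the limit [+oo], so points of vanishing density are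
    covered. *)
Lemma cvg_root_defect y : (0 <= y)%R ->
  (root_defect n y)%:E @[n --> \oo] --> (y - 1)%:E - lne y%:E.
Proof.
rewrite le_eqVlt => /predU1P[<-|y0].
  rewrite le0_lneNy// /=.
  under eq_fun => n.
    rewrite /root_defect powR0 ?invr_eq0 ?pnatr_eq0// (_ : _ - _ = n%:R)%R; last first.
      by rewrite -natr1; ring.
    over.
  exact/cvgeryP/cvgr_idn.
rewrite lne_EFin// -EFinB.
apply: (@squeeze_cvge _ _ _ _ (fun n => (y - 1 - ln y * expR (n.+1%:R^-1 * ln y))%:E)
  _ (fun=> (y - 1 - ln y)%:E)).
- by apply: nearW => n; rewrite !lee_fin root_defect_ge// root_defect_le.
- have c1 : (n.+1%:R^-1 * ln y)%R @[n --> \oo] --> (0 * ln y)%R.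
    by apply: cvgM; [exact: cvg_harmonic|exact: cvg_cst].
  rewrite mul0r in c1.
  have c2 : expR (n.+1%:R^-1 * ln y)%R @[n --> \oo] --> expR (0 : R).
    exact: continuous_cvg (@continuous_expR R 0%R) c1.
  rewrite expR0 in c2.
  apply: cvg_EFin; first exact: nearW.
  apply: cvgB; first exact: cvg_cst.
  by rewrite -[X in _ --> X]mulr1; apply: cvgM; [exact: cvg_cst|exact: c2].
- exact: cvg_cst.
Qed.

End root_defect.

(** * The reverse divergence [KL P0 P1] and the supremum of [Lambda] *)

Section reverse.
Context d (X : measurableType d) (R : realType).
Variables (P0 P1 : probability X R) (f : X -> R).
Hypotheses (mf : measurable_fun [set: X] f) (f0 : forall x, (0 <= f x)%R).
Hypothesis P1E : forall A, measurable A -> P1 A = \int[P0]_(x in A) (f x)%:E.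

Let mEf : measurable_fun [set: X] (EFin \o f).
Proof. exact/measurable_EFinP. Qed.

Lemma integral_real_density (h : X -> \bar R) : measurable_fun [set: X] h ->
  (forall x, 0 <= h x) -> \int[P1]_x h x = \int[P0]_x (h x * (f x)%:E).
Proof. by move=> mh h0; apply: integral_density. Qed.

Lemma real_density1 : \int[P0]_x (f x)%:E = 1.
Proof. by rewrite -P1E// probability_setT. Qed.

Lemma integrable_real_density : P0.-integrable [set: X] (EFin \o f).
Proof.
apply/integrableP; split => //=.
under eq_integral do rewrite ger0_norm//.
by rewrite real_density1 ltry.
Qed.

Lemma real_density_gt0 : {ae P1, forall x, (0 < f x)%R}.
Proof.
have mA : measurable [set x | f x = 0%R].
  by rewrite -[X in measurable X]setTI; exact: (mf measurableT (measurable_set1 0%R)).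
exists [set x | f x = 0%R]; split => //.
  by rewrite [LHS]P1E// integral0_eq// => x /= ->.
by move=> x /= /negP; rewrite -leNgt => fx; apply: le_anti; rewrite fx f0.
Qed.

(** On a P1-null set [f] has P0-integral zero, so it vanishes there a.e.; positivity of [f] then
    makes the set P0-null. *)
Lemma dominates_real_density : {ae P0, forall x, (0 < f x)%R} -> P0 `<< P1.
Proof.
move=> fpos; apply/null_content_dominatesP => A mA A0.
apply: measure_negligible => //.
have : \int[P0]_(x in A) `|(f x)%:E| = 0.
  by under eq_integral do rewrite gee0_abs ?lee_fin//; rewrite -P1E.
move/(ae_eq_integral_abs P0 mA (measurable_funTS mEf)) => fA.
suff : {ae P0, forall x, ~ A x} by apply: negligibleS => x /= Ax; apply.
apply: filterS2 fpos fA => x fx fA /fA /= [] fx0.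
by rewrite fx0 ltxx in fx.
Qed.

Lemma ae_P1_P0 (Q : X -> Prop) : P0 `<< P1 ->
  {ae P1, forall x, Q x} -> {ae P0, forall x, Q x}.
Proof.
move=> P01 [N [mN N0 sN]]; exists N; split => //.
by move/null_content_dominatesP : P01; apply.
Qed.

(* Where [f x = 0] (a [P0]-null set here) [ln] takes the junk value [0]. *)
Lemma KL_reverse : P0 `<< P1 -> KL P0 P1 = \int[P0]_x (- ln (f x))%:E.
Proof.
move=> P01; rewrite /KL asboolT//.
have fpos := ae_P1_P0 P01 real_density_gt0.
pose fi x : R := (f x `^ (- 1))%R.
have mfi : measurable_fun [set: X] fi.
  exact: (@measurableT_comp _ _ _ _ _ _ (@powR R ^~ (- 1)%R)).
set g := Radon_Nikodym _ _.
have mg : measurable_fun [set: X] g.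
  apply: (measurable_int P1).
  exact: (Radon_Nikodym_integrable (nu := charge_of_finite_measure P0)).
(* The reciprocal of [f] has the right integrals over measurable sets, so it is a version of
   dP0/dP1. *)
have gfi : ae_eq P1 [set: X] g (EFin \o fi).
  apply: integral_ae_eq => //.
  - exact: (Radon_Nikodym_integrable (nu := charge_of_finite_measure P0)).
  - exact/measurable_EFinP.
  move=> A _ mA.
  rewrite -(Radon_Nikodym_integral (nu := charge_of_finite_measure P0) P01 mA).
  have mfiA : measurable_fun [set: X] ((EFin \o fi) \_ A).
    by apply/(measurable_restrictT _ mA); apply: measurable_funTS; exact/measurable_EFinP.
  rewrite integral_mkcond integral_real_density//; last first.
    by move=> x; rewrite patchE; case: ifPn => //= _; rewrite lee_fin powR_ge0.
  transitivity (\int[P0]_x ((cst 1) \_ A) x).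
    by rewrite -integral_mkcond integral_cst// mul1e.
  apply: ae_eq_integral => //.
  - by apply/(measurable_restrictT _ mA); apply: measurable_funTS.
  - exact: emeasurable_funM.
  apply: filterS fpos => x fx _; rewrite !patchE; case: ifPn => _; last by rewrite mul0e.
  by rewrite /fi/= -EFinM powR_inv1// mulVf// gt_eqF.
apply: ae_eq_integral => //.
- exact: measurableT_comp (@measurable_lne R) mg.
- apply/measurable_EFinP; apply: measurableT_comp => //.
  exact: measurableT_comp (@measurable_ln R) mf.
apply: filterS2 (ae_P1_P0 P01 gfi) fpos => x gx fx _.
rewrite -/(g x) gx//= /fi powR_inv1// -lnV ?posrE//.
by rewrite -[RHS]lne_EFin ?invr_gt0.
Qed.

Let mln : measurable_fun [set: X] (fun x => ln (f x)).
Proof. exact: measurableT_comp (@measurable_ln R) mf. Qed.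

(** The negative part of [- ln f] is dominated by [f], which has integral 1; finiteness of
    [KL P0 P1] controls the positive part. *)
Lemma integrable_ln_density : P0 `<< P1 -> KL P0 P1 < +oo ->
  P0.-integrable [set: X] (EFin \o (fun x => ln (f x))).
Proof.
move=> P01; rewrite KL_reverse// => kl.
have : P0.-integrable [set: X] (fun x => (- ln (f x))%:E).
  have mNln : measurable_fun [set: X] (fun x => (- ln (f x))%:E).
    by apply/measurable_EFinP; exact: measurableT_comp.
  apply: integrable_funeneg_lty => //.
  apply: (@le_lt_trans _ _ (\int[P0]_x (f x)%:E)); last first.
    by rewrite real_density1 ltry.
  apply: ge0_le_integral => //; first exact: measurable_funeneg.
  move=> x _; rewrite funenegE -EFinN opprK -EFin_max lee_fin ge_max f0 andbT.
  have := f0 x; rewrite le_eqVlt => /predU1P[<-|fx]; first by rewrite ln0.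
  by rewrite ltW// ln_sublinear.
move/integrableN; apply: eq_integrable => // x _ /=.
by rewrite opprK.
Qed.

Lemma integral_npoweR (E : X -> \bar R) (s : R) : P0 `<< P1 ->
  measurable_fun [set: X] E ->
  \int[P1]_x npoweR (E x) s = \int[P0]_x ((expR (ln (f x)))%:E * npoweR (E x) s).
Proof.
move=> P01 mE.
have mnE : measurable_fun [set: X] (fun x => npoweR (E x) s).
  exact: measurableT_comp (measurable_npoweR s) mE.
rewrite integral_real_density//; last by move=> x; exact: npoweR_ge0.
apply: ae_eq_integral => //.
- exact: emeasurable_funM.
- apply: emeasurable_funM => //; apply/measurable_EFinP.
  exact: measurableT_comp.
apply: filterS (ae_P1_P0 P01 real_density_gt0) => x fx _.
by rewrite muleC lnK// posrE.
Qed.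

Lemma KL_fin_reverse : P0 `<< P1 -> KL P0 P1 < +oo ->
  exists2 K : R, KL P0 P1 = K%:E & \int[P0]_x (ln (f x))%:E = (- K)%:E.
Proof.
move=> P01 kl; have il := integrable_ln_density P01 kl.
exists (- fine (\int[P0]_x (ln (f x))%:E))%R; last first.
  by rewrite opprK fineK//; exact: integrable_fin_num il.
rewrite KL_reverse//; under eq_integral do rewrite EFinN.
rewrite integralN ?integrable_add_def// EFinN fineK//.
exact: integrable_fin_num il.
Qed.

Lemma Lambda_le (E : X -> \bar R) : evars P0 E -> Lambda P1 E <= KL P0 P1.
Proof.
move=> hE; have [P01|nP01] := pselect (P0 `<< P1); last first.
  by rewrite /KL asboolF// leey.
have [kl|] := ltP (KL P0 P1) +oo; last by rewrite leye_eq => /eqP ->; rewrite leey.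
have [K -> lK] := KL_fin_reverse P01 kl.
apply: ge_ereal_sup => _ [s s0 <-]; apply: oppe_lne_le.
rewrite integral_npoweR//; last by case: hE.
exact: (tilted_lower_bound0 mln (integrable_ln_density P01 kl) lK hE s0).
Qed.

(** If [ln f] did not exceed its mean [- K] on a set of positive mass, [ae_eq_le_integral] against
    the constant [- K] would make it a.e. constant. *)
Lemma ln_density_gt_pos (K : R) : P0.-integrable [set: X] (EFin \o (fun x => ln (f x))) ->
  \int[P0]_x (ln (f x))%:E = (- K)%:E ->
  ~ {ae P0, forall x, ln (f x) = (- K)%R} ->
  0 < P0 [set x | (- K < ln (f x))%R].
Proof.
move=> il lK nK; rewrite lt_neqAle measure_ge0 andbT eq_sym; apply/eqP => A0.
apply: nK.
have : {ae P0, forall x, (ln (f x))%:E = (- K)%:E}.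
  apply: (ae_eq_le_integral (g := cst (- K)%:E)).
  - exact/measurable_EFinP.
  - exact: (finite_measure_integrable_cst P0 (- K)%R measurableT).
  - exists [set x | (- K < ln (f x))%R]; split => //.
      rewrite (_ : [set x | _] = (fun x => ln (f x)) @^-1` `]- K, +oo[)%R; last first.
        by apply/seteqP; split => x /=; rewrite in_itv/= andbT.
      by rewrite -[X in measurable X]setTI; apply: mln.
    by move=> x /= /negP; rewrite lee_fin -ltNge.
  - rewrite integral_cst// lK [X in _ * X]probability_setT mule1//.
by apply: filterS => x [].
Qed.

(** The bound [K'] of [entropy_gap] holds for all [s] at once, so strictness survives the
    supremum. *)
Lemma Lambda_lt (E : X -> \bar R) : P0 `<< P1 -> KL P0 P1 < +oo ->
  (forall K : R, ~ {ae P0, forall x, ln (f x) = K}) ->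
  evars P0 E -> Lambda P1 E < KL P0 P1.
Proof.
move=> P01 kl nconst hE; have il := integrable_ln_density P01 kl.
have [K -> lK] := KL_fin_reverse P01 kl.
have Kpos := ln_density_gt_pos il lK (nconst _).
have [K' K'K gap] := entropy_gap mln il lK hE Kpos.
apply: (@le_lt_trans _ _ K'%:E); last by rewrite lte_fin.
apply: ge_ereal_sup => _ [s s0 <-]; apply: oppe_lne_le.
by rewrite integral_npoweR//; [exact: gap|case: hE].
Qed.

Let mroot (a : R) : measurable_fun [set: X] (fun x => f x `^ a)%R.
Proof. exact: (@measurableT_comp _ _ _ _ _ _ (@powR R ^~ a)). Qed.

Let mdefect n : measurable_fun [set: X] (fun x => (root_defect n (f x))%:E).
Proof.
apply/measurable_EFinP; apply: measurable_funB; first exact: measurable_funB.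
by apply: measurable_funM => //; apply: measurable_funB.
Qed.

(** The witness is the root of [f] of order [n.+1] divided by its mean [m], tested at [s = n.+1]. As
    [f] has mean 1, the left side is [n.+1 * (1 - m)], which is at most [- n.+1 * ln m]. *)
Lemma root_defect_le_Lambda n : exists2 E, evars P0 E &
  \int[P0]_x (root_defect n (f x))%:E <= Lambda P1 E.
Proof.
pose y x : R := (f x `^ (n.+1%:R^-1))%R.
have y0 x : (0 <= y x)%R by exact: powR_ge0.
have my : measurable_fun [set: X] y by exact: mroot.
have ynf x : (y x ^+ n.+1 = f x)%R.
  by rewrite -powR_mulrn// -powRrM mulVf ?pnatr_eq0// powRr1.
have i1 k := finite_measure_integrable_cst P0 k measurableT.
have iy : P0.-integrable [set: X] (EFin \o y).
  apply: (@le_integrable _ _ _ P0 _ measurableT _ (EFin \o (cst 1 \+ f)%R)).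
  - exact/measurable_EFinP.
  - move=> x _ /=; rewrite lee_fin !ger0_norm ?addr_ge0//.
    (* Bernoulli gives [n.+1 * (y - 1) <= f - 1]; thus [y <= 1] or [y <= f], and [1 + f] dominates
       [y]. *)
    have := root_defect_ge0 n (f0 x); rewrite /root_defect -/(y x) subr_ge0.
    have := y0 x; have : (1 <= n.+1%:R :> R)%R by rewrite ler1n.
    have [|] := leP (y x) 1%R; first by have := f0 x; lra.
    by move=> y1 n1 _; have := f0 x; nra.
  - exact: (integrableD measurableT (i1 1%R) integrable_real_density).
pose m := fine (\int[P0]_x (y x)%:E).
have mE : \int[P0]_x (y x)%:E = m%:E by rewrite fineK//; exact: integrable_fin_num iy.
have m0 : (0 < m)%R.
  rewrite lt_neqAle fine_ge0 ?andbT; last first.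
    by apply: integral_ge0 => x _; rewrite lee_fin.
  apply/eqP => m0.
  have : \int[P0]_x `|(y x)%:E| = 0.
    by under eq_integral do rewrite gee0_abs ?lee_fin//; rewrite mE -m0.
  have mEy : measurable_fun [set: X] (EFin \o y) by exact/measurable_EFinP.
  move/(ae_eq_integral_abs P0 measurableT mEy) => yae.
  have := real_density1; rewrite (ae_eq_integral (cst 0))//; last first.
    by apply: filterS yae => x /(_ I)/= [] yx _; rewrite -ynf yx expr0n.
  by rewrite integral0 => /esym/eqP; rewrite onee_eq0.
pose E x := (y x / m)%:E.
have mEE : measurable_fun [set: X] E.
  by apply/measurable_EFinP; exact: measurable_funM.
have hE : evars P0 E.
  split => //; first by move=> x; rewrite lee_fin divr_ge0// ltW.
  rewrite /E; under eq_integral do rewrite mulrC EFinM.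
  by rewrite integralZl// mE -EFinM mulVf// gt_eqF.
exists E => //.
have defE : \int[P0]_x (root_defect n (f x))%:E = (n.+1%:R * (1 - m))%:E.
  have iny : P0.-integrable [set: X] (EFin \o (fun x => (- n.+1%:R) * y x)%R).
    by have := integrableZl measurableT (- n.+1%:R)%R iy.
  have ifny : P0.-integrable [set: X] (EFin \o (fun x => f x + (- n.+1%:R) * y x)%R).
    by have := integrableD measurableT integrable_real_density iny.
  transitivity (\int[P0]_x ((cst (n.+1%:R - 1)%R x)%:E + (f x + (- n.+1%:R) * y x)%:E)).
    apply: eq_integral => x _; rewrite -EFinD; congr EFin.
    by rewrite /root_defect -/(y x) /cst; ring.
  rewrite (integralD measurableT (i1 _) ifny).
  under [X in _ + X]eq_integral do rewrite /= EFinD.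
  rewrite (integralD measurableT integrable_real_density iny).
  under [X in _ + (_ + X)]eq_integral do rewrite /= EFinM.
  rewrite integralZl// mE real_density1.
  rewrite [X in X + _](integral_cst P0 measurableT (n.+1%:R - 1)%:E).
  rewrite [X in _ * X + _]probability_setT mule1.
  by rewrite -!EFinM -!EFinD; congr EFin; ring.
rewrite defE; apply: (@le_trans _ _ (- lne (\int[P1]_x npoweR (E x) n.+1%:R))); last first.
  by apply: ereal_sup_ubound; exists n.+1%:R => //=.
have I_le : \int[P1]_x npoweR (E x) n.+1%:R <= (m ^+ n.+1)%:E.
  rewrite integral_real_density//; last 2 first.
  - exact: measurableT_comp (measurable_npoweR _) mEE.
  - by move=> x; exact: npoweR_ge0.
  apply: (@le_trans _ _ (\int[P0]_x (m ^+ n.+1)%:E)); last first.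
    rewrite [leLHS](integral_cst P0 measurableT (m ^+ n.+1)%:E).
    by rewrite [X in _ * X]probability_setT mule1.
  apply: ge0_le_integral => //.
  - by move=> x _; rewrite mule_ge0 ?npoweR_ge0 ?lee_fin.
  - apply: emeasurable_funM => //.
    exact: measurableT_comp (measurable_npoweR _) mEE.
  (* Where [f x = 0] the integrand is [+oo * 0 = 0]; elsewhere it equals [m ^+ n.+1]. *)
  move=> x _; have := f0 x; rewrite le_eqVlt => /predU1P[<-|fx].
    by rewrite mule0 lee_fin exprn_ge0// ltW.
  rewrite /npoweR/E/= powR_mulrn ?divr_ge0 ?(ltW m0)// exprMn ynf.
  rewrite inver mulf_eq0 expf_eq0/= invr_eq0 !gt_eqF//=.
  by rewrite -EFinM lee_fin exprVn invfM invrK mulrAC mulVf ?gt_eqF// mul1r.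
rewrite leeNr -EFinN.
apply: (@le_trans _ _ (lne (m ^+ n.+1)%:E)).
  rewrite lee_lne// !in_itv/= leey andbT.
    by apply: integral_ge0 => x _; exact: npoweR_ge0.
  by rewrite lee_fin exprn_ge0// ltW.
rewrite lne_EFin ?exprn_gt0// lnXn// lee_fin -[leLHS]mulr_natl -mulrN ler_wpM2l// opprB.
exact: ln_le_subr1.
Qed.

(** Fatou bounds the integral of [phi] by the supremum. If that integral is infinite the claim is
    immediate; if finite, it forces [f > 0] P0-a.e., so P1 dominates P0 and the formula for the
    reverse divergence is available. *)
Lemma KL_le_sup : KL P0 P1 <= ereal_sup [set Lambda P1 E | E in evars P0].
Proof.
set S := ereal_sup _.
pose phi x := (f x - 1)%:E - lne (f x)%:E.
have phi_le : \int[P0]_x phi x <= S.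
  have phiE x : phi x = limn_einf (fun n => (root_defect n (f x))%:E).
    have := cvg_root_defect (f0 x) => /cvg_limn_einf_sup[-> _] //.
  under eq_integral do rewrite phiE.
  apply: le_trans (fatou P0 measurableT mdefect _) _.
    by move=> n x _; rewrite lee_fin root_defect_ge0.
  rewrite limn_einf_lim; apply: lime_le; first exact: is_cvg_einfs.
  apply: nearW => n; apply: ge_ereal_inf.
  exists (\int[P0]_x (root_defect n (f x))%:E); first by exists n => /=.
  have [E hE /le_trans] := root_defect_le_Lambda n; apply.
  by apply: ereal_sup_ubound; exists E.
have mphi : measurable_fun [set: X] phi.
  apply: emeasurable_funB; first by apply/measurable_EFinP; exact: measurable_funB.
  exact: measurableT_comp (@measurable_lne R) mEf.
have phi0 x : 0 <= phi x.
  rewrite /phi; have := f0 x; rewrite le_eqVlt => /predU1P[<-|fx].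
    by rewrite le0_lneNy//= leey.
  by rewrite lne_EFin// -EFinB lee_fin subr_ge0 ln_le_subr1.
apply: le_trans phi_le; have [phioo|] := ltP (\int[P0]_x phi x) +oo; last first.
  by rewrite leye_eq => /eqP ->; rewrite leey.
have iphi : P0.-integrable [set: X] phi.
  by apply/integrableP; split => //; under eq_integral do rewrite gee0_abs//.
have fpos : {ae P0, forall x, (0 < f x)%R}.
  apply: filterS (integrable_ae measurableT iphi) => x /(_ I).
  rewrite /phi; have := f0 x; rewrite le_eqVlt => /predU1P[<-|//].
  by rewrite le0_lneNy.
have P01 := dominates_real_density fpos.
have i1 := finite_measure_integrable_cst P0 1%R measurableT.
have i1f := integrableB measurableT i1 integrable_real_density.
rewrite KL_reverse//.
(* Adding [1 - f], of integral zero, turns [phi] into [- ln f]. *)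
rewrite (ae_eq_integral (fun x => phi x + ((EFin \o cst 1%R) \- (EFin \o f)) x))//.
- rewrite integralD//.
  rewrite [X in _ + X](integralB measurableT i1 integrable_real_density).
  rewrite real_density1 [X in _ + (X - _)](integral_cst P0 measurableT 1) mul1e.
  by rewrite [X in _ + (X - _)]probability_setT subee// adde0.
- by apply/measurable_EFinP; exact: measurableT_comp.
- by apply: emeasurable_funD => //; exact: measurable_int i1f.
apply: filterS fpos => x fx _; rewrite /phi lne_EFin//= -!EFinB -EFinD.
by congr EFin; ring.
Qed.

End reverse.

(** * Gibbs' inequality and its equality case *)

Section density_facts.
Context d (X : measurableType d) (R : realType).
Variables (P0 P1 : probability X R) (r : X -> \bar R).
Hypotheses (hP10 : P1 `<< P0) (hr : is_density P1 P0 r).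

Let mr : measurable_fun [set: X] r. Proof. by case: hr. Qed.
Let r0 x : 0 <= r x. Proof. by case: hr. Qed.

Lemma density_integral A : measurable A -> P1 A = \int[P0]_(x in A) r x.
Proof.
move=> mA; have [_ _ rE] := hr.
rewrite -[LHS]/(charge_of_finite_measure P1 A).
rewrite (Radon_Nikodym_integral (nu := charge_of_finite_measure P1) hP10 mA).
apply: ae_eq_integral => //; [exact: measurable_funTS|exact: measurable_funTS|].
by apply: ae_eq_sym; apply: ae_eq_subset rE.
Qed.

Lemma integral_P1 (h : X -> \bar R) : measurable_fun [set: X] h ->
  (forall x, 0 <= h x) -> \int[P1]_x h x = \int[P0]_x (h x * r x).
Proof. by move=> mh h0; apply: integral_density => //; exact: density_integral. Qed.

Lemma density_integral1 : \int[P0]_x r x = 1.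
Proof. by rewrite -density_integral// probability_setT. Qed.

Lemma evars_density : evars P0 r.
Proof. by split => //; rewrite density_integral1. Qed.

Lemma integrable_evars E : evars P0 E -> P0.-integrable [set: X] E.
Proof.
move=> [mE E0 E1]; apply/integrableP; split => //.
by under eq_integral do rewrite gee0_abs//; rewrite (le_lt_trans E1) ?ltry.
Qed.

Lemma evars_fin E : evars P0 E -> {ae P0, forall x, E x = (fine (E x))%:E}.
Proof.
move=> /integrable_evars iE.
by apply: filterS (integrable_ae measurableT iE) => x /(_ I) ?; rewrite fineK.
Qed.

Lemma ae_P0_P1 (Q : X -> Prop) : {ae P0, forall x, Q x} -> {ae P1, forall x, Q x}.
Proof.
move=> [N [mN N0 sN]]; exists N; split => //.
by move/null_content_dominatesP : hP10; apply.
Qed.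

Lemma KLE : KL P1 P0 = \int[P1]_x lne (r x).
Proof.
rewrite /KL asboolT//; have [_ _ rE] := hr.
apply: ae_eq_integral => //.
- exact: measurableT_comp (@measurable_lne R) _.
- exact: measurableT_comp (@measurable_lne R) mr.
- apply: (null_dominates_ae_eq measurableT hP10).
  by apply: filterS rE => x + _ => <-.
Qed.

Let f x : R := fine (r x).
Let mf : measurable_fun [set: X] f.
Proof. exact: measurableT_comp mr. Qed.
Let f0 x : (0 <= f x)%R. Proof. exact: fine_ge0. Qed.
Let rf : {ae P0, forall x, r x = (f x)%:E}.
Proof. exact: evars_fin evars_density. Qed.

Lemma fine_density_integral A : measurable A ->
  P1 A = \int[P0]_(x in A) (f x)%:E.
Proof.
move=> mA; rewrite density_integral//; apply: ae_eq_integral => //.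
- exact: measurable_funTS.
- by apply: measurable_funTS; exact/measurable_EFinP.
- by apply: filterS rf => x -> _.
Qed.

Let f_gt0 : {ae P1, forall x, (0 < f x)%R}.
Proof. by apply: real_density_gt0 => //; exact: fine_density_integral. Qed.

(** Under P0 the negative part becomes that of [ln f] times [f], at most 1 since
    [- f * ln f <= 1 - f]; the positive part is then controlled by [KL P1 P0]. *)
Lemma integrable_lne_density : KL P1 P0 < +oo ->
  P1.-integrable [set: X] (fun x => lne (r x)).
Proof.
have ml : measurable_fun [set: X] (fun x => lne (r x)).
  exact: measurableT_comp (@measurable_lne R) mr.
rewrite KLE => kl; apply: integrable_funeneg_lty => //.
rewrite integral_P1//; last exact: measurable_funeneg.
apply: (@le_lt_trans _ _ (\int[P0]_x cst 1 x)); last first.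
  by rewrite integral_cst// mul1e [ltLHS]probability_setT ltry.
apply: ae_le_integral => //.
  by apply: emeasurable_funM => //; exact: measurable_funeneg.
apply: filterS rf => x rx; rewrite funenegE rx.
have := f0 x; rewrite le_eqVlt => /predU1P[<-|fx]; first by rewrite mule0.
rewrite lne_EFin// -EFinN -EFin_max -EFinM lee_fin.
case: (leP (- ln (f x))%R 0%R) => h; first by rewrite mul0r.
have := @ln_le_subr1 _ (f x)^-1 ltac:(by rewrite invr_gt0).
rewrite lnV ?posrE// => lf.
have : (- ln (f x) * f x <= ((f x)^-1 - 1) * f x)%R by rewrite ler_wpM2r// ltW.
by rewrite mulrBl mulVf ?gt_eqF// mul1r => /le_trans; apply; rewrite gerBl ltW.
Qed.

Section gibbs.
Variable E : X -> \bar R.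
Hypotheses (hKL : KL P1 P0 < +oo) (hE : evars P0 E).

Let e x : R := fine (E x).
Let mE : measurable_fun [set: X] E. Proof. by case: hE. Qed.
Let E0 x : 0 <= E x. Proof. by case: hE. Qed.
Let me : measurable_fun [set: X] e.
Proof. exact: measurableT_comp mE. Qed.
Let e0 x : (0 <= e x)%R. Proof. exact: fine_ge0. Qed.

Let q x : R := (e x * (f x) `^ (- 1))%R.
Let mq : measurable_fun [set: X] q.
Proof.
apply: measurable_funM => //.
exact: (@measurableT_comp _ _ _ _ _ _ (@powR R ^~ (- 1)%R)).
Qed.
Let q0 x : (0 <= q x)%R. Proof. by rewrite mulr_ge0// powR_ge0. Qed.
Let qE x : q x = (e x / f x)%R. Proof. by rewrite /q powR_inv1. Qed.

(** Passing to P0 turns [q] into [q * f], which equals [E] where [f > 0] but is [0] where [f = 0];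
    hence only an inequality. *)
Let q1 : \int[P1]_x (q x)%:E <= 1.
Proof.
rewrite integral_P1//; last exact/measurable_EFinP.
case: (hE) => _ _; apply: le_trans; apply: ae_le_integral => //.
  by apply: emeasurable_funM => //; exact/measurable_EFinP.
apply: filterS2 rf (evars_fin hE) => x -> ->; rewrite -EFinM lee_fin qE -/(e x).
have := f0 x; rewrite le_eqVlt => /predU1P[<-|fx]; first by rewrite mulr0.
by rewrite divfK// gt_eqF.
Qed.

Let iq : P1.-integrable [set: X] (EFin \o q).
Proof.
apply/integrableP; split; first exact/measurable_EFinP.
under eq_integral do rewrite /= ger0_norm//.
by rewrite (le_lt_trans q1) ?ltry.
Qed.

(** An integrable majorant of [lne (E x)], from [ln q <= q - 1] with [q = E / r]. *)
Let D x := (q x - 1)%:E + lne (r x).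

Let iD : P1.-integrable [set: X] D.
Proof.
apply: integrableD => //; last exact: integrable_lne_density.
exact: (integrableB measurableT iq (finite_measure_integrable_cst P1 1 measurableT)).
Qed.

Let DE : \int[P1]_x D x <= KL P1 P0.
Proof.
have i1 := finite_measure_integrable_cst P1 1 measurableT.
have iq1 := integrableB measurableT iq i1.
rewrite (integralD measurableT iq1 (integrable_lne_density hKL)) -KLE.
rewrite -[leRHS]add0e leeD2r//.
rewrite [leLHS](integralB measurableT iq i1).
rewrite [X in _ - X](integral_cst P1 measurableT 1) mul1e.
by rewrite [X in _ - X]probability_setT leeBlDr// add0e.
Qed.

Let ED : {ae P1, forall x, [/\ E x = (e x)%:E, r x = (f x)%:E & (0 < f x)%R]}.
Proof. by apply: filterS3 (ae_P0_P1 rf) (ae_P0_P1 (evars_fin hE)) f_gt0. Qed.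

Let lneED : {ae P1, forall x, lne (E x) <= D x}.
Proof.
apply: filterS ED => x [Ex rx fx]; rewrite /D Ex rx.
have := e0 x; rewrite le_eqVlt => /predU1P[<-|ex].
  by rewrite (le0_lneNy (lexx 0)) leNye.
rewrite !lne_EFin// -EFinD lee_fin -lerBlDr -ln_div ?posrE// -qE.
by rewrite ln_le_subr1// qE divr_gt0.
Qed.

Let mlE : measurable_fun [set: X] (fun x => lne (E x)).
Proof. exact: measurableT_comp (@measurable_lne R) mE. Qed.

Lemma gibbs_le : \int[P1]_x lne (E x) <= KL P1 P0.
Proof.
by apply: le_trans DE; apply: ae_le_integral => //; exact: measurable_int iD.
Qed.

(** Equality forces [ln q = q - 1], so [q = 1] and [E = r], but only P1-a.e.; the means under P0
    extend this to P0-a.e. *)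
Lemma gibbs_eq : \int[P1]_x lne (E x) = KL P1 P0 -> ae_eq P0 [set: X] E r.
Proof.
move=> EKL.
have lE : {ae P1, forall x, lne (E x) = D x}.
  by apply: ae_eq_le_integral => //; rewrite EKL.
have mA : measurable [set x | E x != r x].
  rewrite (_ : [set x | _] = (fun x => E x == r x) @^-1` [set false]).
    by rewrite -[X in measurable X]setTI; exact: (measurable_fun_eqe mE mr).
  by apply/seteqP; split => x /=; [exact: negbTE|move=> ->].
have A0 : P1 [set x | E x != r x] = 0.
  apply: measure_negligible => //.
  suff : {ae P1, forall x, E x = r x}.
    by apply: negligibleS => x /= /eqP.
  apply: filterS2 lE ED => x + [Ex rx fx]; rewrite /D Ex rx.
  have := e0 x; rewrite le_eqVlt => /predU1P[<-|ex].
    by rewrite (le0_lneNy (lexx 0)) lne_EFin// -EFinD.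
  rewrite !lne_EFin// -EFinD => -[] /eqP; rewrite -subr_eq -ln_div ?posrE//.
  rewrite -qE => /eqP /ln_eq_subr1; rewrite qE divr_gt0// => /(_ isT) ef.
  by rewrite -[e x](@divfK _ (f x)) ?gt_eqF// ef mul1r.
(* On the P1-null set where [E] and [r] differ, [r] vanishes P0-a.e., so [r <= E]; since the mean of
   [E] is at most that of [r], equality follows. *)
have rE : {ae P0, forall x, r x <= E x}.
  have : \int[P0]_(x in [set x | E x != r x]) `|r x| = 0.
    by under eq_integral do rewrite gee0_abs//; rewrite -density_integral.
  move/(ae_eq_integral_abs P0 mA (measurable_funTS mr)).
  apply: filterS => x; have [->//|Er] := eqVneq (E x) (r x).
  by move=> /(_ Er)/= ->.
have Er : {ae P0, forall x, r x = E x}.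
  apply: ae_eq_le_integral => //; first exact: integrable_evars.
  by rewrite density_integral1; case: hE.
by apply: filterS Er => x ->.
Qed.

End gibbs.

End density_facts.

(** * Both claims, through the real-valued version [fine (r x)] of the density *)

Theorem theorem4p29 (R : realType) (d : measure_display) (X : measurableType d)
    (P0 P1 : probability X R) (r : X -> \bar R)
    (hP10 : P1 `<< P0) (hKL : KL P1 P0 < +oo) (hr : is_density P1 P0 r) :
  [/\ ereal_sup [set \int[P1]_x lne (E x) | E in evars P0] = KL P1 P0,
      evars P0 r,
      \int[P1]_x lne (r x) = KL P1 P0 &
      forall E : X -> \bar R, evars P0 E ->
        \int[P1]_x lne (E x) = KL P1 P0 -> ae_eq P0 [set: X] E r]
  /\
  (ereal_sup [set Lambda P1 E | E in evars P0] = KL P0 P1 /\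
   (P0 `<< P1 -> KL P0 P1 < +oo ->
    ~ (exists c : \bar R, {ae P0, forall x, lne (r x) = c}) ->
    (forall E : X -> \bar R, evars P0 E -> Lambda P1 E <> KL P0 P1) /\
    (forall (PP0 PP1 : probability (trajectories X) R)
            (E : nat -> (nat -> X) -> \bar R) (t : nat),
       is_iid_product P0 PP0 -> is_iid_product P1 PP1 ->
       betting_sequence PP0 E -> (0 < t)%N ->
       Lambda_path PP1 E t < KL P0 P1))).
Proof.
have [mr r0 _] := hr.
pose f x : R := fine (r x).
have mf : measurable_fun [set: X] f by exact: measurableT_comp mr.
have f0 x : (0 <= f x)%R by exact: fine_ge0.
have P1E := fine_density_integral hP10 hr.
split.
  split.
  - apply: le_anti; apply/andP; split.
      by apply: ge_ereal_sup => _ [E hE <-]; exact: (gibbs_le hP10 hr hKL hE).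
    rewrite (KLE hP10 hr); apply: ereal_sup_ubound.
    by exists r => //; exact: (evars_density hP10 hr).
  - exact: (evars_density hP10 hr).
  - by rewrite (KLE hP10 hr).
  - by move=> E hE; exact: (gibbs_eq hP10 hr hKL hE).
split.
  apply: le_anti; apply/andP; split; last exact: (KL_le_sup mf f0 P1E).
  by apply: ge_ereal_sup => _ [E hE <-]; exact: (Lambda_le mf f0 P1E hE).
move=> P01 kl nconst.
have fpos := ae_P1_P0 P01 (real_density_gt0 mf f0 P1E).
(* Since [f] is positive and [r] finite P0-a.e., a constant [ln f] would make [lne r] constant. *)
have nln K : ~ {ae P0, forall x, ln (f x) = K}.
  move=> lnK; apply: nconst; exists K%:E.
  apply: filterS3 lnK fpos (evars_fin (evars_density hP10 hr)) => x <- fx ->.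
  by rewrite lne_EFin.
split.
  move=> E hE; apply/eqP; rewrite lt_eqF//.
  exact: (Lambda_lt mf f0 P1E P01 kl nln hE).
move=> PP0 PP1 E t hPP0 hPP1 hE t0.
have mln : measurable_fun [set: X] (fun x => ln (f x)).
  exact: measurableT_comp (@measurable_ln R) mf.
have il := integrable_ln_density mf f0 P1E P01 kl.
have [K -> lK] := KL_fin_reverse mf f0 P1E P01 kl.
apply: (Lambda_path_lt hPP0 hPP1 mln _ il lK _ hE t0).
  move=> A mA; rewrite P1E//; apply: ae_eq_integral => //.
  - by apply: measurable_funTS; exact/measurable_EFinP.
  - apply: measurable_funTS; apply/measurable_EFinP.
    exact: measurableT_comp mln.
  - by apply: filterS fpos => x fx _; rewrite lnK.
exact: (ln_density_gt_pos mf il lK (nln _)).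
Qed.
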